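(* Let $m\ge 1$, let $f:(S^1)^m\to\mathbb{C}$ be given by $f(z_1,\dots,z_m)=\sum_{j=1}^m z_j$, and let $b\in\mathbb{C}$ be a regular value of $f$. The function $\rho_b:M_b\to S^1$ is a Morse function, and the index of the critical point $z^K$ is equal to $|K|-1$ (for every $K$ for which $z^K$ exists in $M_b$).
   Context: $T^m=(S^1)^m$ is the product of $m$ unit circles in $\mathbb{C}$. $M_b=f^{-1}(b)$, a submanifold of $T^m$ of codimension $2$. $\rho_b:M_b\to S^1$ is the restriction to $M_b$ of $\rho(z_1,\dots,z_m)=z_1z_2\cdots z_m$. Morse function and index of a critical point for the $S^1$-valued function $\rho_b$ are understood through local real-valued lifts $\tilde\rho_b$ with $\rho_b=e^{i\tilde\rho_b}$. The critical points of $\rho_b$ are the configurations $z=(z_1,\dots,z_m)\in M_b$ such that the sequence $z_j$ takes exactly two values (there are none if $b=0$). Such a critical point $z$ is determined by the set $K(z)=\{j\mid \mathrm{Im}\langle z_j,b\rangle<0\}\subset\{1,\dots,m\}$, where $\langle z,w\rangle=z\bar w$. For a proper non-empty subset $K$ of $\{1,\dots,m\}$, $z^K$ denotes the critical point in $M_b$ with $K(z^K)=K$; it exists in $M_b$ if and only if $\big|m-2|K|\big|<|b|<m$. *)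

(* Defs.v *)
From HB Require Import structures.
From mathcomp Require Import all_boot all_order all_algebra.
From mathcomp Require Import complex.
From mathcomp Require Import all_classical all_reals all_analysis.

Set Implicit Arguments.
Unset Strict Implicit.
Unset Printing Implicit Defensive.

Import Order.TTheory GRing.Theory Num.Theory.
Import numFieldNormedType.Exports.

Local Open Scope ring_scope.

(* C^m. The [^o] only gives R[i] its normed topology over itself; R[i]^o is
   convertible to R[i]. *)
Definition Cspace (R : realType) (m : nat) := 'rV[R[i]^o]_m.

(* U is meant to be open, so that the values of g outside U do not affect the
   derivatives at points of U. *)
Fixpoint Ck_on (R : realType) (k n : nat) (U : set 'rV[R]_k)
    (g : 'rV[R]_k -> R) : Prop :=
  if n is n'.+1 then
    (forall x, U x -> differentiable g x) /\
    (forall v, Ck_on n' U (fun x => 'D_v g x))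
  else forall x, U x -> {for x, continuous g}.

Definition smooth_on (R : realType) (k : nat) (U : set 'rV[R]_k)
    (g : 'rV[R]_k -> R) : Prop :=
  forall n, Ck_on n U g.

Section Submanifolds.
Variables (R : realType) (m k : nat).
Implicit Types (X : set (Cspace R m)) (U : set 'rV[R]_k).
Implicit Types (phi : 'rV[R]_k -> Cspace R m) (h : 'rV[R]_k -> R).

(* Regular parametrization of a k-dimensional submanifold X of C^m = R^(2m): a
   smooth immersion which is a homeomorphism of the open set U onto an open
   subset of X. Its inverse is a chart of X. *)
Definition local_param X U phi : Prop :=
  [/\ open U,
      forall j, smooth_on U (fun x => complex.Re (phi x ord0 j)) /\
                smooth_on U (fun x => complex.Im (phi x ord0 j)),
      {in U &, injective phi},
      forall x v, U x ->
        (forall j, 'D_v (fun y => complex.Re (phi y ord0 j)) x = 0 /\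
                   'D_v (fun y => complex.Im (phi y ord0 j)) x = 0) ->
        v = 0 &
      forall V : set 'rV[R]_k, open V -> (V `<=` U)%classic ->
        exists2 W : set (Cspace R m),
          open W & (phi @` V)%classic = (X `&` W)%classic].

(* F is smooth on C^m; surjectivity of the differential of its restriction to X
   does not depend on the parametrization. *)
Definition regular_value X (F : Cspace R m -> R[i]) (b : R[i]) : Prop :=
  forall z, X z -> F z = b ->
    exists U phi u,
      [/\ local_param X U phi, U u, phi u = z &
          forall w : R[i], exists v,
            'D_v (fun x => complex.Re (F (phi x))) u = complex.Re w /\
            'D_v (fun x => complex.Im (F (phi x))) u = complex.Im w].

(* h is, in the chart phi around z = phi u, a local real-valued lift of the
   S^1-valued function g on X: g = e^(i h). *)
Definition local_lift X (g : Cspace R m -> R[i]) (z : Cspace R m)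
    U phi (u : 'rV[R]_k) h : Prop :=
  [/\ local_param X U phi, U u, phi u = z, smooth_on U h &
      forall x, U x -> g (phi x) = (cos (h x) +i* sin (h x))%C].

Definition smooth_circle_map X (g : Cspace R m -> R[i]) : Prop :=
  forall z, X z -> exists U phi u h, local_lift X g z U phi u h.

(* Independent of the chart and of the lift; z lies in X by local_lift. *)
Definition critical_point X (g : Cspace R m -> R[i]) (z : Cspace R m) : Prop :=
  exists U phi u h,
    local_lift X g z U phi u h /\ (forall v, 'D_v h u = 0).

Definition hessian h (u : 'rV[R]_k) : 'M[R]_k :=
  \matrix_(i, j) 'D_(delta_mx ord0 i) (fun x => 'D_(delta_mx ord0 j) h x) u.

Definition negative_definite_on (H W : 'M[R]_k) : Prop :=
  forall v : 'rV[R]_k, (v <= W)%MS -> v != 0 ->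
    (v *m H *m v^T) ord0 ord0 < 0.

(* Index of a symmetric bilinear form: the largest dimension of a subspace (the
   row space of W) on which it is negative definite. *)
Definition form_index (H : 'M[R]_k) (n : nat) : Prop :=
  (exists2 W : 'M[R]_k, negative_definite_on H W & \rank W = n) /\
  (forall W : 'M[R]_k, negative_definite_on H W -> (\rank W <= n)%N).

Definition nondegenerate_at X (g : Cspace R m -> R[i]) (z : Cspace R m) :
    Prop :=
  forall U phi u h, local_lift X g z U phi u h -> hessian h u \in unitmx.

Definition morse_function X (g : Cspace R m -> R[i]) : Prop :=
  smooth_circle_map X g /\
  (forall z, critical_point X g z -> nondegenerate_at X g z).

Definition morse_index X (g : Cspace R m -> R[i]) (z : Cspace R m) (n : nat) :
    Prop :=
  forall U phi u h, local_lift X g z U phi u h -> form_index (hessian h u) n.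

End Submanifolds.

Arguments regular_value {R m} k X F b.
Arguments smooth_circle_map {R m} k X g.
Arguments critical_point {R m} k X g z.
Arguments nondegenerate_at {R m} k X g z.
Arguments morse_function {R m} k X g.
Arguments morse_index {R m} k X g z n.

Section Chains.
Variables (R : realType) (m : nat).

Definition torus : set (Cspace R m) :=
  [set z : Cspace R m | forall j, `|z ord0 j : R[i]| = 1]%classic.

Definition fsum (z : Cspace R m) : R[i] := \sum_(j < m) (z ord0 j : R[i]).

Definition rho (z : Cspace R m) : R[i] := \prod_(j < m) (z ord0 j : R[i]).

Definition fiber (b : R[i]) : set (Cspace R m) :=
  [set z : Cspace R m | torus z /\ fsum z = b]%classic.

(* The fiber over a regular value has codimension 2 in T^m. Subtraction is
   truncated, but for m < 2 the fiber over a regular value is empty. *)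
Definition fiber_dim : nat := (m - 2)%N.

Definition Kset (b : R[i]) (z : Cspace R m) : {set 'I_m} :=
  [set j : 'I_m | complex.Im ((z ord0 j : R[i]) * (b ^*)%C) < 0]%SET.

(* z is the critical point z^K of the restriction of rho to the fiber. *)
Definition is_zK (b : R[i]) (K : {set 'I_m}) (z : Cspace R m) : Prop :=
  critical_point fiber_dim (fiber b) rho z /\ Kset b z = K.

End Chains.

Arguments torus : clear implicits.
Arguments fsum {R m} z.
Arguments rho {R m} z.
Arguments fiber {R} m b.

(* Main.v *)
Require Import Defs.
From HB Require Import structures.
From mathcomp Require Import all_boot all_order all_algebra.
From mathcomp Require Import complex.
From mathcomp Require Import all_classical all_reals all_analysis.
From mathcomp Require Import ring lra zify.
Set Implicit Arguments.
Unset Strict Implicit.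
Unset Printing Implicit Defensive.
Import Order.TTheory GRing.Theory Num.Theory.
Import numFieldNormedType.Exports.
Local Open Scope ring_scope.

(** Write [z_l] for the coordinates of a point of the fiber. Along a path in
    the torus each coordinate turns, [dz_l = i t_l z_l] with [t_l] real, so a
    tangent vector of the fiber is a real vector [t] with [sum t_l z_l = 0],
    and a local lift [h] of [rho] satisfies [dh = sum t_l] ([derive_lift]).
    Since [b] is regular, the [z_l] are not all parallel
    ([regular_nonparallel]), so this tangent space has dimension [m - 2] and is
    the annihilator of the two vectors [(Re z_l)] and [(Im z_l)].

    Hence [z] is critical iff the all-ones vector is a combination of these
    two: [a Re z_l + d Im z_l = 1] for all [l] ([critical_multiplier]).
    Differentiating [sum t_l z_l = 0] along the fiber shows that the Hessian of
    [h] at such a point is [sum c_l t_l ^ 2] with [c_l = a Im z_l - d Re z_l]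
    ([hessian_lift]). As [|z_l| = 1], [1 + c_l ^ 2 = a ^ 2 + d ^ 2], so [c_l]
    takes two opposite values; both occur, otherwise all [z_l] would coincide.
    The tangent space becomes the set of [t] whose sum vanishes over
    [K = {l | c_l < 0}] and over its complement, and there the form is
    nondegenerate with a maximal negative subspace of dimension [#|K| - 1]
    ([diag_form_unit], [diag_form_index]). Finally
    [(a ^ 2 + d ^ 2) Im (z_l conj b)] is the sum over [k] of [c_l - c_k], which is
    negative exactly when [c_l < 0], so [K] is the set [K(z)].

    All of this is computed in an arbitrary parametrization and with an
    arbitrary lift, and the condition on [a] and [d] only involves [z];
    therefore no change of charts is ever made.

    It remains to see that the fiber has parametrizations and [rho] local
    lifts. Two coordinates that are not parallel are determined by their sum
    [w] up to the order, as [w (1/2 + i s)] and [w (1/2 - i s)] with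
    [s = sqrt (1 / |w| ^ 2 - 1/4)], and the other [m - 2] coordinates are
    parametrized stereographically ([chart_param]). A lift is a constant plus
    twice the arctangent of the stereographic coordinate of
    [rho (phi x) / rho (phi u)] ([local_lift_exists]). *)

(** * Derivatives *)

(** The difference [g - f] is differentiable because it vanishes near [x], hence
    is negligible there; add it to [f]. *)
Lemma near_eq_differentiable (R : realType) (V W : normedModType R) (f g : V -> W) x :
  (\forall y \near x, f y = g y) -> differentiable f x -> differentiable g x.
Proof.
move=> fg df; pose d : V -> W := g - f.
have d0 : \forall h \near (0 : V), d (h + x) = 0.
  have : {near x, d =1 cst 0} by near=> y; rewrite /d !fctE (near fg y)// subrr.
  by rewrite (near_shift 0) /= subr0.
have dE : d \o shift x = cst (d x) + (\0 : V -> W) +o_ (0 : V) id.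
  have dx : d x = 0 by move/nbhs_singleton : d0; rewrite add0r.
  have E (a c : W) : a = 0 -> c = 0 -> a - (c + 0) = 0.
    by move=> -> ->; rewrite addr0 subrr.
  apply/eqaddoP => _/posnumP[e]; apply: filterS d0 => h dh.
  by rewrite [X in `|X| <= _](E _ _ dh dx) normr0 mulr_ge0.
have dd : 'd d x = \0 :> (V -> W) by apply: diff_unique dE; exact: cst_continuous.
have -> : g = f + d by rewrite /d addrC subrK.
apply: differentiableD => //; apply/diff_locallyP; rewrite dd; split => //.
exact: cst_continuous.
Unshelve. all: by end_near. Qed.

Lemma derive_comp1 (R : realType) (V : normedModType R) (f : V -> R) (s : R -> R)
    (ds : R) (x v : V) :
  differentiable f x -> is_derive (f x) (1 : R) s ds ->
  'D_v (s \o f) x = ds * 'D_v f x.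
Proof.
move=> df [sx sE]; have dsf : differentiable s (f x) by apply/derivable1_diffP.
rewrite !deriveE; [|exact: df|exact: differentiable_comp].
have -> : 'd (s \o f) x v = 'd s (f x) ('d f x v) by rewrite diff_comp.
by rewrite diff1E ?derive1E ?sE; [rewrite mulrC|exact: dsf].
Qed.

Lemma derive_bigsum (R : realType) (V : normedModType R) (I : Type) (r : seq I)
    (F : I -> V -> R) (x v : V) :
  (forall i, differentiable (F i) x) ->
  'D_v (fun y => \sum_(i <- r) F i y) x = \sum_(i <- r) 'D_v (F i) x.
Proof.
move=> dF; elim: r => [|i r IH].
  rewrite big_nil; under [X in 'D_v X _]funext do rewrite big_nil; exact: derive_cst.
have dr : differentiable (fun y => \sum_(j <- r) F j y) x.
  elim: r {IH} => [|j r IH].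
    by under [X in differentiable X _]funext do rewrite big_nil; exact: differentiable_cst.
  by under [X in differentiable X _]funext do rewrite big_cons; exact: differentiableD.
under [X in 'D_v X _]funext do rewrite big_cons.
by rewrite big_cons -IH deriveD //; apply: diff_derivable.
Qed.

Lemma open_eq_derive (R : realType) (V W : normedModType R) (U : set V) (f g : V -> W) (x v : V) :
  open U -> U x -> (forall y, U y -> f y = g y) -> 'D_v f x = 'D_v g x.
Proof.
move=> oU Ux fg; apply: near_eq_derive.
have : \forall y \near x, U y by exact: open_nbhs_nbhs.
by apply: filterS => y /fg.
Qed.

(** * Smooth functions on open sets *)

Section Smooth.
Variables (R : realType) (k : nat).
Implicit Types (U : set 'rV[R]_k) (f g : 'rV[R]_k -> R).

(** Derivatives at a point of an open set only see the values on this set. This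
    lets the differentiation rules, which hold on [U] only, be used inside the
    inductions on the order of smoothness below. *)
Lemma Ck_on_ext U n f g : open U -> (forall x, U x -> f x = g x) ->
  Ck_on n U f -> Ck_on n U g.
Proof.
move=> oU; have near_U x : U x -> (\forall y \near x, U y).
  by move=> Ux; exact: open_nbhs_nbhs.
elim: n f g => [|n IH] f g fg /=.
  move=> cf x Ux; have := cf x Ux.
  rewrite /prop_for /continuous_at (fg _ Ux) => cfx.
  apply: cvg_trans (near_eq_cvg _) cfx.
  by apply: filterS (near_U _ Ux) => y /fg.
move=> [df Df]; split=> [x Ux|v].
  apply: near_eq_differentiable (df x Ux).
  by apply: filterS (near_U _ Ux) => y /fg.
apply: IH (Df v) => x Ux; apply: near_eq_derive.
by apply: filterS (near_U _ Ux) => y /fg.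
Qed.

Lemma Ck_onW U n f : Ck_on n.+1 U f -> Ck_on n U f.
Proof.
elim: n f => [|n IH] f [df Df].
  by move=> x /df; exact: differentiable_continuous.
by split=> // v; exact/IH/Df.
Qed.

Lemma smooth_on_differentiable U f x : smooth_on U f -> U x -> differentiable f x.
Proof. by move=> /(_ 1%N)[df _]; exact: df. Qed.

Lemma smooth_on_derive U f v : smooth_on U f -> smooth_on U (fun x => 'D_v f x).
Proof. by move=> sf n; have [_ /(_ v)] := sf n.+1. Qed.

Lemma Ck_on_cst U n c : Ck_on n U (fun=> c).
Proof.
elim: n c => [|n IH] c /=; first by move=> x _; exact: cst_continuous.
split=> [x _|v]; first exact: differentiable_cst.
rewrite (_ : 'D_v _ = fun=> 0) //.
by apply/funext => x; exact: derive_cst.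
Qed.

Lemma derive_coord j (x v : 'rV[R]_k) : 'D_v (fun y : 'rV[R]_k => y ord0 j) x = v ord0 j.
Proof.
rewrite deriveE; last exact: differentiable_coord.
have @l : {linear 'rV[R]_k -> R}.
  by exists (fun y : 'rV[R]_k => y ord0 j); do 2![eexists]; do ?[constructor];
     rewrite ?mxE// => ? *; rewrite ?mxE//; move=> ?; rewrite !mxE.
by rewrite (_ : (fun _ => _) = l) // diff_lin //; exact: coord_continuous.
Qed.

Lemma Ck_on_coord U n j : Ck_on n U (fun x => x ord0 j).
Proof.
case: n => [|n] /=; first by move=> x _; exact: coord_continuous.
split=> [x _|v]; first exact: differentiable_coord.
rewrite (_ : 'D_v _ = fun=> v ord0 j); first exact: Ck_on_cst.
by apply/funext => x; exact: derive_coord.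
Qed.

Lemma Ck_onD U n f g : open U -> Ck_on n U f -> Ck_on n U g ->
  Ck_on n U (fun x => f x + g x).
Proof.
move=> oU; elim: n f g => [|n IH] f g.
  by move=> cf cg x Ux; apply: continuousD; [exact: cf | exact: cg].
move=> [df Df] [dg Dg]; split=> [x Ux|v].
  by apply: differentiableD; [exact: df | exact: dg].
apply: (Ck_on_ext oU _ (IH _ _ (Df v) (Dg v))) => x Ux.
by rewrite deriveD //; apply: diff_derivable; [exact: df | exact: dg].
Qed.

Lemma Ck_onM U n f g : open U -> Ck_on n U f -> Ck_on n U g ->
  Ck_on n U (fun x => f x * g x).
Proof.
move=> oU; elim: n f g => [|n IH] f g.
  by move=> cf cg x Ux; apply: continuousM; [exact: cf | exact: cg].
move=> Cf Cg; have [df Df] := Cf; have [dg Dg] := Cg; split=> [x Ux|v].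
  by apply: differentiableM; [exact: df | exact: dg].
have := Ck_onD oU (IH _ _ (Ck_onW Cf) (Dg v)) (IH _ _ (Ck_onW Cg) (Df v)).
apply: (Ck_on_ext oU) => x Ux.
by rewrite deriveM //; apply: diff_derivable; [exact: df | exact: dg].
Qed.

(** The derivative of [s \o f] is [(s' \o f) * 'D_v f]. For the inverse and the
    square root, [s'] is again expressed by [s], so smoothness of the composite
    follows by induction on the order. *)
Lemma Ck_on_comp U n (s s' : R -> R) f : open U ->
  (forall x, U x -> is_derive (f x) (1 : R) s (s' (f x))) ->
  Ck_on n.+1 U f -> Ck_on n U (s' \o f) -> Ck_on n.+1 U (s \o f).
Proof.
move=> oU ds [df Df] Cs'.
have dsf x : U x -> differentiable s (f x).
  by move=> Ux; apply/derivable1_diffP; case: (ds x Ux).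
split=> [x Ux|v].
  by apply: differentiable_comp; [exact: df | exact: dsf].
apply: (Ck_on_ext oU _ (Ck_onM oU Cs' (Df v))) => x Ux /=.
by rewrite (derive_comp1 v (df x Ux) (ds x Ux)).
Qed.

Lemma Ck_onV U n f : open U -> (forall x, U x -> f x != 0) -> Ck_on n U f ->
  Ck_on n U (fun x => (f x)^-1).
Proof.
move=> oU f0; elim: n f f0 => [|n IH] f f0.
  by move=> cf x Ux; apply: continuousV; [exact: f0 | exact: cf].
move=> Cf; apply: (@Ck_on_comp _ _ GRing.inv (fun y => - (y ^+ 2)^-1)) => //.
  move=> x /f0 fx0.
  have -> : - (f x ^+ 2)^-1 = - f x ^- 2 *: (1 : R).
    by rewrite -[RHS]/(_ * _) mulr1.
  exact: is_deriveV.
have Ci := IH _ f0 (Ck_onW Cf).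
have := Ck_onM oU (Ck_onM oU (Ck_on_cst U n (-1)) Ci) Ci.
by apply: (Ck_on_ext oU) => x Ux /=; rewrite mulN1r mulNr -expr2 exprVn.
Qed.

Lemma Ck_on_sqrt U n f : open U -> (forall x, U x -> 0 < f x) -> Ck_on n U f ->
  Ck_on n U (fun x => Num.sqrt (f x)).
Proof.
move=> oU f0; elim: n f f0 => [|n IH] f f0.
  by move=> cf x Ux; apply: (@continuous_comp _ _ _ f Num.sqrt);
    [exact: cf | exact: sqrt_continuous].
move=> Cf; apply: (@Ck_on_comp _ _ Num.sqrt (fun y => (2 * Num.sqrt y)^-1)) => //.
  by move=> x /f0 fx0; exact: is_derive1_sqrt.
apply: (@Ck_onV _ _ (fun x => 2 * Num.sqrt (f x))) => //.
  by move=> x /f0 fx0; rewrite mulf_neq0// sqrtr_eq0 -ltNge.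
by apply: Ck_onM => //; [exact: Ck_on_cst | apply: IH => //; exact: Ck_onW].
Qed.

Lemma Ck_on_atan U n f : open U -> Ck_on n U f -> Ck_on n U (fun x => atan (f x)).
Proof.
move=> oU; case: n f => [|n] f.
  by move=> cf x Ux; apply: (@continuous_comp _ _ _ f atan);
    [exact: cf | exact: continuous_atan].
move=> Cf; apply: (@Ck_on_comp _ _ atan (fun y => (1 + y ^+ 2)^-1)) => //.
apply: (@Ck_onV _ _ (fun x => 1 + f x ^+ 2)) => //.
  by move=> x _; rewrite gt_eqF// ltr_pwDl// sqr_ge0.
apply: Ck_onD => //; first exact: Ck_on_cst.
have C := Ck_onW Cf.
by under [X in Ck_on _ _ X]funext do rewrite expr2; exact: Ck_onM.
Qed.

Lemma Ck_onB U n f g : open U -> Ck_on n U f -> Ck_on n U g ->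
  Ck_on n U (fun x => f x - g x).
Proof.
move=> oU Cf Cg; apply: (Ck_on_ext oU _ (Ck_onD oU Cf (Ck_onM oU (Ck_on_cst U n (-1)) Cg))).
by move=> x _ /=; rewrite mulN1r.
Qed.

Lemma Ck_on_sum (I : Type) (r : seq I) (P : pred I) U n (F : I -> 'rV[R]_k -> R) :
  open U -> (forall i, P i -> Ck_on n U (F i)) ->
  Ck_on n U (fun x => \sum_(i <- r | P i) F i x).
Proof.
move=> oU CF; elim: r => [|i r IH].
  apply: (Ck_on_ext oU _ (Ck_on_cst U n 0)) => x _; by rewrite big_nil.
case Pi : (P i).
  by apply: (Ck_on_ext oU _ (Ck_onD oU (CF _ Pi) IH)) => x _; rewrite big_cons Pi.
by apply: (Ck_on_ext oU _ IH) => x _; rewrite big_cons Pi.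
Qed.

End Smooth.

(** * Complex numbers in real coordinates *)

Local Notation sqn a := (complex.Re a ^+ 2 + complex.Im a ^+ 2).

Section ComplexCoordinates.
Variable R : realType.
Implicit Types a b c : R[i].

Lemma complex_ReM (a b : R[i]) : complex.Re (a * b) =
  complex.Re a * complex.Re b - complex.Im a * complex.Im b.
Proof. by case: a b => [? ?] [? ?]. Qed.

Lemma complex_ImM (a b : R[i]) : complex.Im (a * b) =
  complex.Re a * complex.Im b + complex.Im a * complex.Re b.
Proof. by case: a b => [? ?] [? ?]. Qed.

Lemma complex_ReD (a b : R[i]) : complex.Re (a + b) = complex.Re a + complex.Re b.
Proof. by case: a b => [? ?] [? ?]. Qed.

Lemma complex_ImD (a b : R[i]) : complex.Im (a + b) = complex.Im a + complex.Im b.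
Proof. by case: a b => [? ?] [? ?]. Qed.

Lemma complex_Re_sum (I : Type) (r : seq I) (P : pred I) (f : I -> R[i]) :
  complex.Re (\sum_(i <- r | P i) f i) = \sum_(i <- r | P i) complex.Re (f i).
Proof. exact: (big_morph _ complex_ReD). Qed.

Lemma complex_Im_sum (I : Type) (r : seq I) (P : pred I) (f : I -> R[i]) :
  complex.Im (\sum_(i <- r | P i) f i) = \sum_(i <- r | P i) complex.Im (f i).
Proof. exact: (big_morph _ complex_ImD). Qed.

Lemma normc1P (a : R[i]) : `|a| = 1 <-> complex.Re a ^+ 2 + complex.Im a ^+ 2 = 1.
Proof.
rewrite normc_def; split => [/complexI /(congr1 (fun t => t ^+ 2))|->].
  by rewrite sqr_sqrtr ?addr_ge0 ?sqr_ge0 // expr1n.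
by rewrite sqrtr1.
Qed.

Lemma mulJc a : sqn a = 1 -> a * (a^*)%C = 1.
Proof.
by case: a => x y /= xy; apply/eqP; rewrite eq_complex complex_ReM complex_ImM /= -xy;
  apply/andP; split; apply/eqP; ring.
Qed.

Lemma sqnM a c : sqn (a * c) = sqn a * sqn c.
Proof. by rewrite complex_ReM complex_ImM; ring. Qed.

Lemma sqnJ a : sqn (a^*)%C = sqn a.
Proof. by case: a => x y /=; rewrite sqrrN. Qed.

End ComplexCoordinates.

(** * Angular velocity of maps to the unit circle *)

Section AngularVelocity.
Variables (R : realType) (k : nat).
Implicit Types (U : set 'rV[R]_k) (F G : 'rV[R]_k -> R[i]) (h : 'rV[R]_k -> R).

Definition csmooth U F :=
  smooth_on U (fun x => complex.Re (F x)) /\ smooth_on U (fun x => complex.Im (F x)).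

(** The imaginary part of [conj F * 'D_v F], that is, the derivative of the
    argument of [F] when [F] has values in the unit circle. *)
Definition angvel F (v x : 'rV[R]_k) : R :=
  complex.Re (F x) * 'D_v (fun y => complex.Im (F y)) x
  - complex.Im (F x) * 'D_v (fun y => complex.Re (F y)) x.

Definition unit_on U F :=
  forall x, U x -> complex.Re (F x) ^+ 2 + complex.Im (F x) ^+ 2 = 1.

Lemma csmooth_cst U (c : R[i]) : csmooth U (fun=> c).
Proof. by split=> n; exact: Ck_on_cst. Qed.

Lemma csmoothM U F G : open U -> csmooth U F -> csmooth U G -> csmooth U (fun x => F x * G x).
Proof.
move=> oU [rF iF] [rG iG]; split => n.
  by under [X in Ck_on _ _ X]funext do rewrite complex_ReM; apply: Ck_onB => //; exact: Ck_onM.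
by under [X in Ck_on _ _ X]funext do rewrite complex_ImM; apply: Ck_onD => //; exact: Ck_onM.
Qed.

Lemma csmooth_prod U (I : Type) (r : seq I) (F : I -> 'rV[R]_k -> R[i]) :
  open U -> (forall i, csmooth U (F i)) -> csmooth U (fun x => \prod_(i <- r) F i x).
Proof.
move=> oU sF; elim: r => [|i r IH].
  by under [X in csmooth _ X]funext do rewrite big_nil; exact: csmooth_cst.
by under [X in csmooth _ X]funext do rewrite big_cons; exact: csmoothM.
Qed.

Lemma csmooth_diff U F x : csmooth U F -> U x ->
  differentiable (fun y => complex.Re (F y)) x /\ differentiable (fun y => complex.Im (F y)) x.
Proof. by case=> rF iF Ux; split; apply: smooth_on_differentiable Ux. Qed.

Lemma angvel_smooth U F v : open U -> csmooth U F -> smooth_on U (angvel F v).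
Proof.
move=> oU [rF iF] n; apply: Ck_onB => //; apply: Ck_onM => //.
  exact: (smooth_on_derive v iF).
exact: (smooth_on_derive v rF).
Qed.

(** Differentiating [|F| ^ 2 = 1] shows that ['D_v F] is a real multiple of
    [i F]; the factor is the angular velocity. *)
Lemma unit_derive U F v x : open U -> csmooth U F -> unit_on U F -> U x ->
  'D_v (fun y => complex.Re (F y)) x = - (complex.Im (F x) * angvel F v x) /\
  'D_v (fun y => complex.Im (F y)) x = complex.Re (F x) * angvel F v x.
Proof.
move=> oU sF uF Ux; have [dr di] := csmooth_diff sF Ux.
have := open_eq_derive v oU Ux uF; rewrite derive_cst.
under [X in 'D_v X _]funext do rewrite !expr2.
rewrite deriveD; [|by apply/diff_derivable/differentiableM..].
rewrite !deriveM; [|by apply: diff_derivable..].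
have := uF x Ux; rewrite /angvel /GRing.scale /=.
set X := complex.Re _; set Y := complex.Im _; set dX := 'D_v _ _; set dY := 'D_v _ _.
move=> XY E; have {}E : X * dX + Y * dY = 0 by lra.
split.
  have -> : - (Y * (X * dY - Y * dX)) = (X ^+ 2 + Y ^+ 2) * dX - X * (X * dX + Y * dY) by ring.
  by rewrite XY E mulr0 subr0 mul1r.
have -> : X * (X * dY - Y * dX) = (X ^+ 2 + Y ^+ 2) * dY - Y * (X * dX + Y * dY) by ring.
by rewrite XY E mulr0 subr0 mul1r.
Qed.

(** Arguments add up under multiplication. *)
Lemma angvelM U F G v x : csmooth U F -> csmooth U G ->
  unit_on U F -> unit_on U G -> U x ->
  angvel (fun y => F y * G y) v x = angvel F v x + angvel G v x.
Proof.
move=> sF sG uF uG Ux; have [drF diF] := csmooth_diff sF Ux.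
have [drG diG] := csmooth_diff sG Ux.
rewrite /angvel complex_ReM complex_ImM.
have -> := open_eq_derive v openT I (fun y _ => complex_ImM (F y) (G y)) :> _ = 'D_v _ x.
have -> := open_eq_derive v openT I (fun y _ => complex_ReM (F y) (G y)) :> _ = 'D_v _ x.
rewrite deriveD; [|by apply/diff_derivable/differentiableM..].
rewrite deriveB; [|by apply/diff_derivable/differentiableM..].
rewrite !deriveM; [|by apply: diff_derivable..].
have := uF x Ux; have := uG x Ux; rewrite /GRing.scale /=.
set dX := 'D_v (fun y => complex.Re (F y)) x; set dY := 'D_v (fun y => complex.Im (F y)) x.
set dZ := 'D_v (fun y => complex.Re (G y)) x; set dW := 'D_v (fun y => complex.Im (G y)) x.
set X := complex.Re (F x); set Y := complex.Im (F x).
set Z := complex.Re (G x); set W := complex.Im (G x).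
move=> ZW XY.
transitivity ((Z ^+ 2 + W ^+ 2) * (X * dY - Y * dX) + (X ^+ 2 + Y ^+ 2) * (Z * dW - W * dZ)).
  by ring.
by rewrite ZW XY !mul1r.
Qed.

Lemma unit_onM U F G : unit_on U F -> unit_on U G -> unit_on U (fun x => F x * G x).
Proof.
move=> uF uG x Ux; apply/normc1P; rewrite normrM.
by move/normc1P: (uF x Ux) => ->; move/normc1P: (uG x Ux) => ->; rewrite mulr1.
Qed.

Lemma angvel_prod U (I : Type) (r : seq I) (F : I -> 'rV[R]_k -> R[i]) v x :
  open U -> (forall i, csmooth U (F i)) -> (forall i, unit_on U (F i)) -> U x ->
  unit_on U (fun x => \prod_(i <- r) F i x) /\
  angvel (fun y => \prod_(i <- r) F i y) v x = \sum_(i <- r) angvel (F i) v x.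
Proof.
move=> oU sF uF Ux; elim: r => [|i r [IH1 IH2]].
  under [X in unit_on _ X]funext do rewrite big_nil; under [X in angvel X]funext do rewrite big_nil.
  split; first by move=> y Uy; rewrite /= expr0n addr0 expr1n.
  by rewrite /angvel !derive_cst !mulr0 subr0 big_nil.
under [X in unit_on _ X]funext do rewrite big_cons; under [X in angvel X]funext do rewrite big_cons.
split; first exact: unit_onM.
by rewrite big_cons -IH2; apply: angvelM Ux => //; exact: csmooth_prod.
Qed.

Lemma angvel_expi U F h v x : open U -> smooth_on U h ->
  (forall y, U y -> F y = (cos (h y) +i* sin (h y))%C) -> U x ->
  angvel F v x = 'D_v h x.
Proof.
move=> oU sh FE Ux; have dh := smooth_on_differentiable sh Ux.
rewrite /angvel (open_eq_derive (g := sin \o h) v oU Ux) => [|y /FE-> //].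
rewrite (open_eq_derive (f := fun y => complex.Re (F y)) (g := cos \o h) v oU Ux) => [|y /FE-> //].
rewrite (derive_comp1 v dh (is_derive_sin _)) (derive_comp1 v dh (is_derive_cos _)).
rewrite (FE x Ux) /=; transitivity ((cos (h x) ^+ 2 + sin (h x) ^+ 2) * 'D_v h x); first by ring.
by rewrite cos2Dsin2 mul1r.
Qed.

Lemma angvel_linear U F x (v : 'rV[R]_k) : csmooth U F -> U x ->
  angvel F v x = \sum_i v ord0 i * angvel F (delta_mx ord0 i) x.
Proof.
move=> sF Ux; have [dr di] := csmooth_diff sF Ux.
have D f : differentiable f x -> 'D_v f x = \sum_i v ord0 i * 'D_(delta_mx ord0 i) f x.
  move=> df; rewrite deriveE // {1}(row_sum_delta v) linear_sum; apply: eq_bigr => i _.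
  by rewrite linearZ deriveE.
rewrite /angvel !D // !mulr_sumr -sumrB; apply: eq_bigr => i _.
by ring.
Qed.

End AngularVelocity.

(** * Derivatives in a parametrization of the fiber *)

Section Frame.
Variables (R : realType) (m k : nat).
Implicit Types (X : set (Cspace R m)) (U : set 'rV[R]_k).
Implicit Types (phi : 'rV[R]_k -> Cspace R m) (h : 'rV[R]_k -> R).

Definition coordfun phi (l : 'I_m) : 'rV[R]_k -> R[i] := fun p => phi p ord0 l.

(** Tangent vectors at a point of the torus are identified with real vectors,
    listing the angular velocities of the coordinates. The rows are the images
    of the basis vectors under the differential of [phi], so [v *m frame phi u]
    is the image of [v] ([frame_angvel]). *)
Definition frame phi u : 'M[R]_(k, m) :=
  \matrix_(i, l) angvel (coordfun phi l) (delta_mx ord0 i) u.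

(** The image of [U] itself is the intersection of [X] with an open set. *)
Lemma local_param_in X U phi x : local_param X U phi -> U x -> X (phi x).
Proof.
move=> [oU _ _ _ /(_ U oU (@subset_refl _ U))[W _ UW]] Ux.
have : (phi @` U)%classic (phi x) by exists x.
by rewrite UW => -[].
Qed.

Lemma local_param_csmooth X U phi l : local_param X U phi -> csmooth U (coordfun phi l).
Proof. by case=> _ /(_ l). Qed.

Lemma local_param_unit X U phi l : (X `<=` torus R m)%classic -> local_param X U phi ->
  unit_on U (coordfun phi l).
Proof. by move=> Xt P x Ux; apply/normc1P; exact: (Xt _ (local_param_in P Ux)). Qed.

Lemma frame_angvel X U phi u (v : 'rV[R]_k) l : local_param X U phi -> U u ->
  angvel (coordfun phi l) v u = (v *m frame phi u) ord0 l.
Proof.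
move=> P Uu; rewrite (angvel_linear _ (local_param_csmooth l P) Uu) mxE.
by apply: eq_bigr => i _; rewrite mxE.
Qed.

(** [phi] is an immersion, and the derivative of each coordinate is determined
    by its angular velocity. *)
Lemma frame_free X U phi u : (X `<=` torus R m)%classic -> local_param X U phi -> U u ->
  row_free (frame phi u).
Proof.
move=> Xt P Uu; rewrite -kermx_eq0 -submx0; apply/rV_subP => v /sub_kermxP vA.
case: (P) => oU _ _ imm _; rewrite (imm _ v Uu) ?sub0mx // => l.
have [-> ->] := unit_derive v oU (local_param_csmooth l P) (local_param_unit l Xt P) Uu.
by rewrite (frame_angvel _ _ P Uu) vA mxE !mulr0 oppr0.
Qed.

(** The equation [sum t_l z_l = 0] of the tangent space of the fiber, in real
    coordinates: the derivative of [sum z_l = b]. *)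
Lemma angvel_fiber b U phi x v : local_param (fiber m b) U phi -> U x ->
  \sum_l angvel (coordfun phi l) v x * complex.Re (coordfun phi l x) = 0 /\
  \sum_l angvel (coordfun phi l) v x * complex.Im (coordfun phi l x) = 0.
Proof.
move=> P Ux; have oU : open U by case: P.
have Xt : (fiber m b `<=` torus R m)%classic by move=> z [].
have sF l := local_param_csmooth l P.
have uF l := local_param_unit l Xt P.
have sum_b y : U y -> \sum_l coordfun phi l y = b.
  by move=> /(local_param_in P)[].
have rb y : U y -> \sum_l complex.Re (coordfun phi l y) = complex.Re b.
  by move=> /sum_b <-; rewrite complex_Re_sum.
have ib y : U y -> \sum_l complex.Im (coordfun phi l y) = complex.Im b.
  by move=> /sum_b <-; rewrite complex_Im_sum.
have dr l := (csmooth_diff (sF l) Ux).1; have di l := (csmooth_diff (sF l) Ux).2.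
split.
  have := open_eq_derive v oU Ux ib; rewrite derive_cst derive_bigsum // => E; rewrite -[RHS]E.
  by apply: eq_bigr => l _; rewrite (unit_derive v oU (sF l) (uF l) Ux).2 mulrC.
have := open_eq_derive v oU Ux rb; rewrite derive_cst derive_bigsum // => /eqP.
rewrite -oppr_eq0 => /eqP E; rewrite -[RHS]E -sumrN.
by apply: eq_bigr => l _; rewrite (unit_derive v oU (sF l) (uF l) Ux).1 mulrC opprK.
Qed.

(** The argument of a product is the sum of the arguments of the factors. *)
Lemma derive_lift X U phi u h z v x : (X `<=` torus R m)%classic ->
  local_lift X rho z U phi u h -> U x ->
  'D_v h x = \sum_l angvel (coordfun phi l) v x.
Proof.
move=> Xt [P _ _ sh hE] Ux; have oU : open U by case: P.
rewrite -(angvel_expi v oU sh hE Ux) /rho.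
have [_ <-] := angvel_prod (index_enum 'I_m) v oU (fun l => local_param_csmooth l P)
  (fun l => local_param_unit l Xt P) Ux.
by [].
Qed.

(** The second derivatives of [h] are the sums over [l] of the derivatives of the
    angular velocities. By the choice of [a] and [d], each such sum is
    [a E1 + d E2], where [E1] and [E2] are the same sums weighted by the real and
    imaginary parts of the [z_l]; these are known from differentiating the
    equations of the tangent space once more. *)
Lemma hessian_lift b U phi u h z (a d : R) :
  local_lift (fiber m b) rho z U phi u h ->
  (forall l, a * complex.Re (coordfun phi l u) + d * complex.Im (coordfun phi l u) = 1) ->
  hessian h u = frame phi u *m
    diag_mx (\row_l (a * complex.Im (coordfun phi l u) - d * complex.Re (coordfun phi l u)))
    *m (frame phi u)^T.
Proof.
move=> L ad; case: (L) => P Uu _ sh _; have oU : open U by case: P.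
have Xt : (fiber m b `<=` torus R m)%classic by move=> y [].
have sF l := local_param_csmooth l P.
have uF l := local_param_unit l Xt P.
apply/matrixP => i j; rewrite [LHS]mxE.
set v := delta_mx ord0 j; set w := delta_mx ord0 i.
pose A l := angvel (coordfun phi l) v.
have sA l : smooth_on U (A l) by exact: angvel_smooth.
have dA l : differentiable (A l) u by exact: smooth_on_differentiable (sA l) Uu.
have dr l := (csmooth_diff (sF l) Uu).1; have di l := (csmooth_diff (sF l) Uu).2.
have D l := unit_derive w oU (sF l) (uF l) Uu.
have E1 : \sum_l 'D_w (A l) u * complex.Re (coordfun phi l u) =
    \sum_l A l u * angvel (coordfun phi l) w u * complex.Im (coordfun phi l u).
  have := open_eq_derive w oU Uu (fun y Uy => (angvel_fiber v P Uy).1).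
  rewrite derive_cst derive_bigsum => [|l]; last exact: (differentiableM (dA l) (dr l)).
  move=> /eqP; rewrite (eq_bigr (fun l => 'D_w (A l) u * complex.Re (coordfun phi l u)
    - A l u * angvel (coordfun phi l) w u * complex.Im (coordfun phi l u))) => [|l _].
    by rewrite sumrB subr_eq0 => /eqP.
  rewrite (deriveM (diff_derivable (dA l)) (diff_derivable (dr l))).
  by rewrite (D l).1 /GRing.scale /= /A; ring.
have E2 : \sum_l 'D_w (A l) u * complex.Im (coordfun phi l u) =
    - \sum_l A l u * angvel (coordfun phi l) w u * complex.Re (coordfun phi l u).
  have := open_eq_derive w oU Uu (fun y Uy => (angvel_fiber v P Uy).2).
  rewrite derive_cst derive_bigsum => [|l]; last exact: (differentiableM (dA l) (di l)).
  move=> /eqP; rewrite (eq_bigr (fun l => 'D_w (A l) u * complex.Im (coordfun phi l u)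
    + A l u * angvel (coordfun phi l) w u * complex.Re (coordfun phi l u))) => [|l _].
    by rewrite big_split /= addr_eq0 => /eqP.
  rewrite (deriveM (diff_derivable (dA l)) (diff_derivable (di l))).
  by rewrite (D l).2 /GRing.scale /= /A; ring.
have -> : 'D_w (fun x => 'D_v h x) u = \sum_l 'D_w (A l) u.
  rewrite (open_eq_derive w oU Uu (fun y Uy => derive_lift v Xt L Uy)).
  by rewrite derive_bigsum.
transitivity (a * (\sum_l 'D_w (A l) u * complex.Re (coordfun phi l u)) +
              d * (\sum_l 'D_w (A l) u * complex.Im (coordfun phi l u))).
  rewrite !mulr_sumr -big_split /=; apply: eq_bigr => l _.
  by rewrite -[LHS]mulr1 -(ad l); ring.
rewrite E1 E2 mxE mulrN !mulr_sumr -sumrB; apply: eq_bigr => l _.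
by rewrite mul_mx_diag !mxE /A -/v -/w; ring.
Qed.

End Frame.

(** * Diagonal forms restricted to a balanced subspace *)

Section DiagonalForm.
Variables (R : realType) (k m : nat) (A : 'M[R]_(k, m)) (c : 'I_m -> R).
Implicit Types (S : {set 'I_m}) (v w : 'rV[R]_k).

Let H := A *m diag_mx (\row_j c j) *m A^T.
Let K := [set j | c j < 0]%SET.

Lemma diag_formE v w :
  (v *m H *m w^T) ord0 ord0 = \sum_j c j * (v *m A) ord0 j * (w *m A) ord0 j.
Proof.
have -> : v *m H *m w^T = v *m A *m diag_mx (\row_j c j) *m (w *m A)^T.
  by rewrite /H trmx_mul !mulmxA.
rewrite mxE; apply: eq_bigr => j _; rewrite mul_mx_diag !mxE.
by congr (_ * _); rewrite mulrC.
Qed.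

(** The vectors [v] such that [v *m A] vanishes on [S]. *)
Let vanish S := kermx (colsub (enum_val : 'I_#|S| -> 'I_m) A).

Lemma sub_vanishP S v :
  reflect (forall j, j \in S -> (v *m A) ord0 j = 0) (v <= vanish S)%MS.
Proof.
apply: (iffP idP) => [/sub_kermxP|vS].
  rewrite mulmx_colsub => /rowP vS j jS.
  by have := vS (enum_rank_in jS j); rewrite !mxE enum_rankK_in.
apply/sub_kermxP; rewrite mulmx_colsub; apply/rowP => i.
by rewrite [RHS]mxE mxE vS ?enum_valP.
Qed.

(** The columns of [A] indexed by [S] have sum zero, so their rank is less than
    [#|S|]. *)
Lemma rank_vanish S : S != finset.set0 ->
  (forall i, \sum_(j in S) A i j = 0) -> (k <= \rank (vanish S) + (#|S| - 1))%N.
Proof.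
move=> /set0Pn[j0 j0S] AS; rewrite mxrank_ker.
have := @mulmx0_rank_max _ _ _ _ (colsub (enum_val : 'I_#|S| -> 'I_m) A)
  (const_mx 1 : 'cV_#|S|).
have -> : \rank (const_mx 1 : 'cV[R]_#|S|) = 1%N.
  rewrite -mxrank_tr trmx_const rank_rV.
  have [/rowP/(_ (enum_rank_in j0S j0))|//] := eqVneq; rewrite !mxE.
  by move/eqP; rewrite oner_eq0.
move=> H1; have : (\rank (colsub (enum_val : 'I_#|S| -> 'I_m) A) + 1 <= #|S|)%N.
  apply: H1; apply/matrixP => i j; rewrite !mxE.
  rewrite (eq_bigr (fun l => A i (enum_val l))) => [|l _].
    by rewrite -(@big_enum_val _ _ _ _ (mem S) (fun j => A i j)) AS.
  by rewrite !mxE mulr1.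
by lia.
Qed.

Hypotheses (c0 : forall j, c j != 0) (A_free : row_free A).
Hypotheses (K0 : K != finset.set0) (KC0 : ~: K != finset.set0).
Hypotheses (AK : forall i, \sum_(j in K) A i j = 0).
Hypotheses (AKC : forall i, \sum_(j in ~: K) A i j = 0).
Hypothesis km : k = (m - 2)%N.

Lemma diag_form_neg v : (v <= vanish (~: K))%MS -> v != 0 ->
  (v *m H *m v^T) ord0 ord0 < 0.
Proof.
move=> /sub_vanishP vK v0; rewrite diag_formE.
have vj j : c j * (v *m A) ord0 j * (v *m A) ord0 j <= 0.
  rewrite -mulrA -expr2; have [cj|cj] := ltP (c j) 0.
    by rewrite mulr_le0_ge0 ?sqr_ge0 ?ltW.
  by rewrite vK ?expr0n ?mulr0 // !inE -leNgt.
rewrite lt_neqAle sumr_le0 // andbT; apply: contraNneq v0 => s0.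
apply/eqP/(row_free_inj A_free); rewrite mul0mx; apply/rowP => j; rewrite [RHS]mxE.
have /eqP : \sum_j - (c j * (v *m A) ord0 j * (v *m A) ord0 j) = 0 by rewrite sumrN s0 oppr0.
rewrite psumr_eq0 => [|i _]; last by rewrite oppr_ge0.
move=> /allP/(_ j); rewrite mem_index_enum => /(_ isT).
by rewrite oppr_eq0 -mulrA !mulf_eq0 (negPf (c0 j)) orbb /= => /eqP.
Qed.

Lemma diag_form_pos v : (v <= vanish K)%MS -> v != 0 ->
  0 < (v *m H *m v^T) ord0 ord0.
Proof.
move=> /sub_vanishP vK v0; rewrite diag_formE.
have vj j : 0 <= c j * (v *m A) ord0 j * (v *m A) ord0 j.
  rewrite -mulrA -expr2; have [cj|cj] := ltP (c j) 0.
    by rewrite vK ?expr0n ?mulr0 // !inE.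
  by rewrite mulr_ge0 ?sqr_ge0.
rewrite lt_neqAle sumr_ge0 // andbT; apply: contraNneq v0 => /esym s0.
apply/eqP/(row_free_inj A_free); rewrite mul0mx; apply/rowP => j; rewrite [RHS]mxE.
move/eqP : s0; rewrite psumr_eq0 => [|i _ //].
move=> /allP/(_ j); rewrite mem_index_enum => /(_ isT).
by rewrite -mulrA !mulf_eq0 (negPf (c0 j)) orbb /= => /eqP.
Qed.

Lemma negdef_cap_pos (W : 'M[R]_k) : negative_definite_on H W ->
  \rank (W :&: vanish K)%MS = 0%N.
Proof.
move=> ndW; apply/eqP; rewrite mxrank_eq0 -submx0; apply/rV_subP => v.
rewrite sub_capmx => /andP[vW vK]; have [->|v0] := eqVneq v 0; first exact: sub0mx.
by have := lt_trans (ndW _ vW v0) (diag_form_pos vK v0); rewrite ltxx.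
Qed.

Lemma card_negC : (#|K| + #|~: K| = m)%N.
Proof. by rewrite cardsC card_ord. Qed.

Lemma rank_vanish_neg : (k <= \rank (vanish K) + (#|K| - 1))%N.
Proof. exact: rank_vanish. Qed.

Lemma rank_vanish_negC : (k <= \rank (vanish (~: K)) + (#|~: K| - 1))%N.
Proof. exact: rank_vanish. Qed.

Lemma card_neg_gt0 : (0 < #|K|)%N.
Proof. by rewrite card_gt0. Qed.

Lemma card_negC_gt0 : (0 < #|~: K|)%N.
Proof. by rewrite card_gt0. Qed.

(** The vectors whose image vanishes on the complement of [K] form a negative
    definite space, those whose image vanishes on [K] a positive definite one.
    The dimensions of these spaces are at least [#|K| - 1] and
    [m - #|K| - 1]. A negative definite space meets the second one trivially,
    hence has dimension at most [(m - 2) - (m - #|K| - 1) = #|K| - 1]. *)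
Lemma diag_form_index : form_index H (#|K| - 1).
Proof.
have Wle W : negative_definite_on H W -> (\rank W <= #|K| - 1)%N.
  move=> /negdef_cap_pos W0; have := mxrank_sum_cap W (vanish K).
  rewrite W0; have := rank_vanish_neg; have := rank_leq_col (W + vanish K)%MS.
  by lia.
have ndK : negative_definite_on H (vanish (~: K)) by exact: diag_form_neg.
split=> //; exists (vanish (~: K)) => //; apply/eqP; rewrite eqn_leq Wle //=.
have arith (r a d : nat) :
    (k <= r + (d - 1) -> a + d = m -> 0 < d -> 0 < a -> a - 1 <= r)%N by lia.
exact: arith rank_vanish_negC card_negC card_negC_gt0 card_neg_gt0.
Qed.

(** The two definite spaces are orthogonal for the form and span everything;
    pairing a vector of the radical with its two components shows that both
    components vanish. *)
Lemma diag_form_unit : H \in unitmx.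
Proof.
rewrite -row_free_unit -kermx_eq0 -submx0; apply/rV_subP => v /sub_kermxP vH.
have orth (a b : 'rV_k) : (a <= vanish (~: K))%MS -> (b <= vanish K)%MS ->
    (b *m H *m a^T) ord0 ord0 = 0 /\ (a *m H *m b^T) ord0 ord0 = 0.
  move=> /sub_vanishP aK /sub_vanishP bK; rewrite !diag_formE.
  by split; apply: big1 => j _; have [jK|jK] := boolP (j \in K);
    rewrite ?(bK _ jK) ?mulr0 ?mul0r // aK ?mulr0 ?mul0r // inE.
have full : row_full (vanish (~: K) + vanish K)%MS.
  rewrite /row_full eqn_leq rank_leq_col /=.
  have := mxrank_sum_cap (vanish (~: K)) (vanish K).
  rewrite (negdef_cap_pos diag_form_neg).
  have arith (t r r' a d : nat) :
      (k <= r' + (a - 1) -> k <= r + (d - 1) -> a + d = m -> 0 < d -> 0 < a ->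
       t + 0 = r + r' -> k <= t)%N by lia.
  exact: arith rank_vanish_neg rank_vanish_negC card_negC card_negC_gt0 card_neg_gt0.
have /sub_addsmxP[[a b] /= vE] := submx_full v full.
have aK : (a *m vanish (~: K) <= vanish (~: K))%MS by exact: submxMl.
have bK : (b *m vanish K <= vanish K)%MS by exact: submxMl.
move: vE aK bK; set a' := a *m _; set b' := b *m _ => vE aK bK.
have [ba ab] := orth _ _ aK bK.
have vH0 (w : 'rV_k) : (v *m H *m w^T) ord0 ord0 = 0 by rewrite vH mul0mx mxE.
have aHa := vH0 a'; have bHb := vH0 b'.
rewrite vE !mulmxDl mxE ba addr0 in aHa; rewrite vE !mulmxDl mxE ab add0r in bHb.
have a0 : a' = 0.
  by apply/eqP; apply: contraT => /(diag_form_neg aK); rewrite aHa ltxx.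
have b0 : b' = 0.
  by apply/eqP; apply: contraT => /(diag_form_pos bK); rewrite bHb ltxx.
by rewrite vE a0 b0 addr0 sub0mx.
Qed.

End DiagonalForm.

(** * Critical points *)

Section Critical.
Variables (R : realType) (m : nat).
Implicit Types (b : R[i]) (z : Cspace R m).

Local Notation re z l := (complex.Re (z ord0 l : R[i])).
Local Notation im z l := (complex.Im (z ord0 l : R[i])).

(** If all coordinates were parallel to a single [z_l0], the differential of
    the sum would have values in the line spanned by [i z_l0], and would miss
    [z_l0]. The sign can be chosen by exchanging [j] and [l]. *)
Lemma regular_nonparallel b z : (1 <= m)%N -> regular_value m (torus R m) fsum b ->
  fiber m b z -> exists j l, 0 < im z j * re z l - re z j * im z l.
Proof.
move=> m1 breg [zt zb]; have [U [phi [u [P Uu uz surj]]]] := breg z zt zb.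
apply: contrapT => npar; pose l0 := Ordinal m1.
have par l : re z l0 * im z l = im z l0 * re z l.
  apply/eqP; rewrite -subr_eq0 eq_sym; apply: contraT => ne; exfalso; apply: npar.
  have [lt|gt|e] := ltgtP 0 (re z l0 * im z l - im z l0 * re z l); last by rewrite -e eqxx in ne.
    by exists l, l0; move: lt; rewrite [re z l0 * _]mulrC [im z l0 * _]mulrC.
  by exists l0, l; rewrite -oppr_gt0 opprB in gt.
have [v [vr vi]] := surj (z ord0 l0).
have oU : open U by case: P.
have sF l := local_param_csmooth l P.
have uF l := local_param_unit l (@subset_refl _ (torus R m)) P.
have D l := unit_derive v oU (sF l) (uF l) Uu.
have dr l := (csmooth_diff (sF l) Uu).1; have di l := (csmooth_diff (sF l) Uu).2.
move: vr; under [X in 'D_v X _]funext do rewrite complex_Re_sum.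
rewrite derive_bigsum // => vr.
move: vi; under [X in 'D_v X _]funext do rewrite complex_Im_sum.
rewrite derive_bigsum // => vi.
have /normc1P := zt l0; apply/eqP; rewrite eq_sym.
suff -> : re z l0 ^+ 2 + im z l0 ^+ 2 = 0 by exact: oner_neq0.
rewrite !expr2 -{1}vr -{1}vi !mulr_suml -big_split big1 //= => l _.
rewrite (D l).1 (D l).2; move: (angvel _ _ _) => t; rewrite /coordfun uz.
transitivity (t * (im z l0 * re z l - re z l0 * im z l)).
  by ring.
by rewrite par subrr mulr0.
Qed.

(** At a critical point the all-ones vector is orthogonal to the tangent space.
    The orthogonal complement of the tangent space has dimension 2 and contains
    the independent vectors of the real and of the imaginary parts of the
    coordinates of [z], so it is spanned by them. *)
Lemma critical_multiplier b z j l : 0 < im z j * re z l - re z j * im z l ->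
  critical_point (fiber_dim m) (fiber m b) rho z ->
  exists a d, forall i, a * re z i + d * im z i = 1.
Proof.
move=> jl [U [phi [u [h [L crit]]]]]; case: (L) => P Uu uz sh _.
have Xt : (fiber m b `<=` torus R m)%classic by move=> y [].
have m2 : (2 <= m)%N.
  rewrite ltnNge; apply: contraTN jl => m1; suff -> : j = l by rewrite mulrC subrr ltxx.
  by apply/ord_inj; have := ltn_ord j; have := ltn_ord l; lia.
set A := frame phi u.
pose B : 'M[R]_(2, m) := \matrix_(i, l) if i == ord0 then re z l else im z l.
have BA : (B <= kermx A^T)%MS.
  apply/sub_kermxP/matrixP => i i'; rewrite mxE [RHS]mxE.
  have [E1 E2] := angvel_fiber (delta_mx ord0 i') P Uu.
  have [i0|i0] := eqVneq i ord0.
    by rewrite -[RHS]E1; apply: eq_bigr => t _; rewrite !mxE i0 -uz mulrC.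
  by rewrite -[RHS]E2; apply: eq_bigr => t _; rewrite !mxE (negPf i0) -uz mulrC.
have B_free : row_free B.
  rewrite -kermx_eq0 -submx0; apply/rV_subP => v /sub_kermxP vB.
  have E t : v ord0 ord0 * re z t + v ord0 ord_max * im z t = 0.
    have /rowP/(_ t) := vB; rewrite !mxE !big_ord_recl big_ord0 addr0 !mxE /= => <-.
    by congr (_ + v _ _ * _); apply/val_inj.
  (* Cramer's rule for the equations of the indices [j] and [l]. *)
  have det0 := lt0r_neq0 jl.
  have v0 : v ord0 ord0 = 0.
    apply: (mulIf det0); rewrite mul0r.
    transitivity (im z j * (v ord0 ord0 * re z l + v ord0 ord_max * im z l)
      - im z l * (v ord0 ord0 * re z j + v ord0 ord_max * im z j)); first by ring.
    by rewrite !E !mulr0 subrr.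
  have v1 : v ord0 ord_max = 0.
    apply: (mulIf det0); rewrite mul0r.
    transitivity (re z l * (v ord0 ord0 * re z j + v ord0 ord_max * im z j)
      - re z j * (v ord0 ord0 * re z l + v ord0 ord_max * im z l)); first by ring.
    by rewrite !E !mulr0 subrr.
  suff -> : v = 0 by exact: sub0mx.
  apply/rowP => i; rewrite [RHS]mxE; case: (unliftP ord0 i) => [i' ->|-> //].
  by rewrite -v1; congr (v _ _); apply/val_inj; rewrite /= (ord1 i').
have kerB : (kermx A^T <= B)%MS.
  have [_ <-] := mxrank_leqif_sup BA.
  rewrite mxrank_ker mxrank_tr (eqP (frame_free Xt P Uu)) (eqP B_free) /fiber_dim.
  by apply/eqP; lia.
have : ((const_mx 1 : 'rV[R]_m) <= B)%MS.
  apply: submx_trans kerB; apply/sub_kermxP/rowP => i; rewrite mxE [RHS]mxE.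
  rewrite -[RHS](crit (delta_mx ord0 i)) (derive_lift _ Xt L Uu).
  by apply: eq_bigr => t _; rewrite !mxE mul1r.
move=> /submxP[D DB]; exists (D ord0 ord0), (D ord0 ord_max) => i.
have /rowP/(_ i) := DB; rewrite !mxE !big_ord_recl big_ord0 addr0 !mxE /= => ->.
by congr (_ + D _ _ * _); apply/val_inj.
Qed.

(** The coefficients [c i] of the Hessian are opposite for the indices [j] and
    [l], and the sum of the [t_i] over [K] is, up to a factor, the difference of
    the two linear forms [c j * sum t_i] and [sum c_i t_i], which both vanish on
    the tangent space. *)
Lemma critical_hessian b z U phi u h j l a d :
  0 < im z j * re z l - re z j * im z l ->
  (forall i, a * re z i + d * im z i = 1) ->
  local_lift (fiber m b) rho z U phi u (h : 'rV[R]_(fiber_dim m) -> R) ->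
  hessian h u \in unitmx /\ form_index (hessian h u) (#|Kset b z| - 1).
Proof.
move=> jl ad L; case: (L) => P Uu uz sh _.
have Xt : (fiber m b `<=` torus R m)%classic by move=> y [].
have [zt zb] : fiber m b z by rewrite -uz; exact: local_param_in P Uu.
pose c i := a * im z i - d * re z i.
have HE : hessian h u = frame phi u *m diag_mx (\row_i c i) *m (frame phi u)^T.
  by rewrite (hessian_lift (a := a) (d := d) L) /coordfun uz.
pose N := a ^+ 2 + d ^+ 2.
(* [1 + i c_i] is the product of [a - i d] with the unit number [z_i]. *)
have c2 i : c i ^+ 2 = N - 1.
  transitivity (N * (re z i ^+ 2 + im z i ^+ 2) - (a * re z i + d * im z i) ^+ 2).
    by rewrite /N /c; ring.
  by rewrite ad expr1n; have /normc1P -> := zt i; rewrite mulr1.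
(* [c i] is the tangent of the argument of [z_i] relative to [a + i d], and the
   cosine of this angle is the same for all indices. *)
have cdet i t : N * (im z i * re z t - re z i * im z t) = c i - c t.
  transitivity (c i * (a * re z t + d * im z t) - c t * (a * re z i + d * im z i)).
    by rewrite /N /c; ring.
  by rewrite !ad !mulr1.
have N0 : 0 < N.
  rewrite lt_neqAle addr_ge0 ?sqr_ge0 // andbT eq_sym; apply: contra_eq_neq (ad j) => /eqP.
  rewrite paddr_eq0 ?sqr_ge0 // !sqrf_eq0 => /andP[/eqP-> /eqP->].
  by rewrite !mul0r addr0 eq_sym oner_neq0.
have clj : c l < c j by rewrite -subr_gt0 -cdet mulr_gt0.
have cjl : c j = - c l.
  have /eqP := c2 j; rewrite -(c2 l) eqf_sqr => /orP[|] /eqP // E.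
  by rewrite E ltxx in clj.
have cl : c l < 0 by move: clj; rewrite cjl; lra.
have c_cases i : c i = c l \/ c i = c j.
  have /eqP := c2 i; rewrite -(c2 l) eqf_sqr => /orP[|] /eqP; first by left.
  by rewrite -cjl; right.
(* Sum [cdet] over [t], as [b] is the sum of the [z_t]. *)
have KE : Kset b z = [set i | c i < 0]%SET.
  apply/setP => i; rewrite !inE -(pmulr_rlt0 _ N0).
  have -> : N * complex.Im ((z ord0 i : R[i]) * (b^*)%C) = \sum_t (c i - c t).
    transitivity (N * (im z i * complex.Re b - re z i * complex.Im b)).
      by rewrite complex_ImM; case: (b) => br bi /=; rewrite mulrN addrC.
    rewrite -zb complex_Re_sum complex_Im_sum !mulr_sumr -sumrB mulr_sumr; apply: eq_bigr => t _.
    exact: cdet.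
  have [->|->] := c_cases i.
    rewrite cl (bigD1 j) //=; have le0 : \sum_(t < m | t != j) (c l - c t) <= 0.
      by apply: sumr_le0 => t _; have [->|->] := c_cases t; lra.
    by apply/idP; move: clj; lra.
  apply/idP/idP; last by move: cl; rewrite cjl; lra.
  rewrite ltNge sumr_ge0 // => t _; have [->|->] := c_cases t; lra.
pose A := frame phi u.
have sA i : \sum_t A i t * re z t = 0 /\ \sum_t A i t * im z t = 0.
  have [E1 E2] := angvel_fiber (delta_mx ord0 i) P Uu; rewrite -uz.
  by split; [rewrite -[RHS]E1 | rewrite -[RHS]E2]; apply: eq_bigr => t _; rewrite !mxE.
have A1 i : \sum_t A i t = 0.
  transitivity (a * (\sum_t A i t * re z t) + d * (\sum_t A i t * im z t)).
    rewrite !mulr_sumr -big_split /=; apply: eq_bigr => t _.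
    by rewrite -[LHS]mulr1 -(ad t); ring.
  by rewrite !(sA i).1 (sA i).2 !mulr0 addr0.
have Ac i : \sum_t A i t * c t = 0.
  transitivity (a * (\sum_t A i t * im z t) - d * (\sum_t A i t * re z t)).
    by rewrite !mulr_sumr -sumrB; apply: eq_bigr => t _; rewrite /c; ring.
  by rewrite (sA i).1 (sA i).2 !mulr0 subr0.
pose K := [set i | c i < 0]%SET.
have AK i : \sum_(t in K) A i t = 0.
  have ne0 : c j - c l != 0 by rewrite lt0r_neq0 // subr_gt0.
  apply: (mulIf ne0).
  rewrite mul0r mulr_suml.
  transitivity (c j * (\sum_t A i t) - \sum_t A i t * c t); last by rewrite A1 Ac mulr0 subrr.
  rewrite mulr_sumr -sumrB big_mkcond; apply: eq_bigr => t _; rewrite inE.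
  have [->|->] := c_cases t; first by rewrite cl; ring.
  by rewrite ltNge ltW /=; [ring | move: cl; rewrite cjl; lra].
have AKC i : \sum_(t in ~: K) A i t = 0.
  have := A1 i; rewrite (bigID (mem K)) /= AK add0r => E; rewrite -[RHS]E.
  by apply: eq_bigl => t; rewrite inE.
have c0 i : c i != 0 by have [->|->] := c_cases i; rewrite ?cjl ?oppr_eq0 lt_eqF.
have K0 : K != finset.set0 by apply/set0Pn; exists l; rewrite inE.
have KC0 : ~: K != finset.set0.
  by apply/set0Pn; exists j; rewrite !inE -leNgt cjl oppr_ge0 ltW.
rewrite HE KE; have Af := frame_free Xt P Uu.
by split; [apply: diag_form_unit | apply: diag_form_index].
Qed.

End Critical.

(** * Stereographic coordinates and arguments on the circle *)

Section CircleLift.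
Variable R : realType.
Implicit Types (t : R) (a c : R[i]).

(** The point [(1 + i t) / (1 - i t)]; every point of the unit circle other than
    [-1] is of this form. *)
Definition stereo t : R[i] := ((1 - t ^+ 2) / (1 + t ^+ 2) +i* (2 * t / (1 + t ^+ 2)))%C.

Definition stereo_inv a : R := complex.Im a / (1 + complex.Re a).

Lemma sqr_add1_neq0 t : 1 + t ^+ 2 != 0.
Proof. by rewrite lt0r_neq0 // ltr_pwDl ?sqr_ge0. Qed.

Lemma stereo_unit t : sqn (stereo t) = 1.
Proof. by rewrite /=; field; exact: sqr_add1_neq0. Qed.

Lemma stereo_Re_gt t : 0 < 1 + complex.Re (stereo t).
Proof.
have -> : 1 + complex.Re (stereo t) = 2 / (1 + t ^+ 2).
  by rewrite /=; field; exact: sqr_add1_neq0.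
by rewrite divr_gt0 // ltr_pwDl ?sqr_ge0.
Qed.

Lemma stereoK : cancel stereo stereo_inv.
Proof.
move=> t; have n0 := lt0r_neq0 (stereo_Re_gt t); apply: (mulIf n0).
by rewrite divfK //=; field; exact: sqr_add1_neq0.
Qed.

Lemma stereo_invK a : sqn a = 1 -> 0 < 1 + complex.Re a -> stereo (stereo_inv a) = a.
Proof.
case: a => x y /= xy /lt0r_neq0 x0; rewrite /stereo_inv /stereo /=.
have E : 1 + (y / (1 + x)) ^+ 2 = 2 / (1 + x).
  apply: (mulIf (mulf_neq0 x0 x0)).
  transitivity (1 + 2 * x + (x ^+ 2 + y ^+ 2)); first by field.
  by rewrite xy; field.
have E' : 1 - (y / (1 + x)) ^+ 2 = 2 * x / (1 + x).
  by rewrite (_ : (y / (1 + x)) ^+ 2 = 2 / (1 + x) - 1); [field | rewrite -E; ring].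
by rewrite E E'; congr (_ +i* _)%C; field.
Qed.

(** Up to a positive factor [1 + i t] has argument [atan t], and [stereo t] is the
    square of its direction. *)
Lemma expi_atan t : (cos (atan t + atan t) +i* sin (atan t + atan t))%C = stereo t.
Proof.
have c0 : cos (atan t) != 0.
  by rewrite cos_atan invr_eq0 sqrtr_eq0 -ltNge ltr_pwDl ?sqr_ge0.
have s : sin (atan t) = t * cos (atan t) by rewrite -{2}(atanK t) /tan divfK.
have c2 : cos (atan t) ^+ 2 = (1 + t ^+ 2)^-1.
  by rewrite cos_atan exprVn sqr_sqrtr // addr_ge0 ?sqr_ge0.
rewrite cosD sinD s /stereo; congr (_ +i* _)%C.
  by transitivity ((1 - t ^+ 2) * cos (atan t) ^+ 2); [ring | rewrite c2].
by transitivity (2 * t * cos (atan t) ^+ 2); [ring | rewrite c2].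
Qed.

(** The point [-1], which is not in the range of [stereo], has argument [pi]. *)
Lemma unit_expi a : sqn a = 1 -> exists t, a = (cos t +i* sin t)%C.
Proof.
move=> a1; have [a0|a0] := ltP 0 (1 + complex.Re a).
  by exists (atan (stereo_inv a) + atan (stereo_inv a)); rewrite expi_atan stereo_invK.
exists pi; rewrite cospi sinpi; case: a a1 a0 => x y /= xy x1.
have xN1 : x = -1.
  apply/eqP; rewrite eq_le; apply/andP; split; first by lra.
  by rewrite -[_ <= _]negbK -ltNge; apply/negP => lt; have : 0 <= y ^+ 2 := sqr_ge0 y; nra.
move: xy; rewrite xN1 sqrrN expr1n => /eqP; rewrite -subr_eq0 addrAC subrr add0r sqrf_eq0.
by move=> /eqP ->.
Qed.

Lemma expiD (s t : R) : (cos (s + t) +i* sin (s + t))%C =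
  (cos s +i* sin s)%C * (cos t +i* sin t)%C.
Proof.
rewrite cosD sinD; apply/eqP; rewrite eq_complex complex_ReM complex_ImM /=.
by apply/andP; split; apply/eqP; ring.
Qed.

(** The points [a] and [c] are the intersections of the unit circle with the
    perpendicular bisector of the segment from [0] to [a + c]; the sign
    condition tells which is which. *)
Lemma unit_pair_split a c : sqn a = 1 -> sqn c = 1 ->
  0 < complex.Im a * complex.Re c - complex.Re a * complex.Im c ->
  [/\ 0 < sqn (a + c) < 4,
      a = (a + c) * (2^-1 +i* Num.sqrt ((sqn (a + c))^-1 - 4^-1))%C &
      c = (a + c) * (2^-1 -i* Num.sqrt ((sqn (a + c))^-1 - 4^-1))%C].
Proof.
rewrite complex_ReD complex_ImD; case: a c => [p1 p2] [q1 q2] /= pp qq D0.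
set n := (p1 + q1) ^+ 2 + (p2 + q2) ^+ 2.
(* [r] and [d] are the cosine and the sine of the angle between the points. *)
pose r := p1 * q1 + p2 * q2; pose d := p2 * q1 - p1 * q2.
have nE : n = 2 * (1 + r).
  transitivity ((p1 ^+ 2 + p2 ^+ 2) + (q1 ^+ 2 + q2 ^+ 2) + 2 * r); first by rewrite /n /r; ring.
  by rewrite pp qq; ring.
have rd : r ^+ 2 + d ^+ 2 = 1.
  transitivity ((p1 ^+ 2 + p2 ^+ 2) * (q1 ^+ 2 + q2 ^+ 2)); first by rewrite /r /d; ring.
  by rewrite pp qq mulr1.
have d2 : 0 < d ^+ 2 by rewrite exprn_gt0.
have n0 : 0 < n by rewrite nE; nra.
have n4 : n < 4 by rewrite nE; nra.
have nn0 := lt0r_neq0 n0.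
have -> : Num.sqrt (n^-1 - 4^-1) = d / n.
  have -> : n^-1 - 4^-1 = (d / n) ^+ 2.
    apply: (mulIf (mulf_neq0 nn0 nn0)); transitivity (d ^+ 2); last by field.
    transitivity (n - n ^+ 2 / 4); first by field.
    by rewrite nE (_ : d ^+ 2 = 1 - r ^+ 2); [field | rewrite -rd; ring].
  by rewrite sqrtr_sqr gtr0_norm // divr_gt0.
have e1 : 2^-1 * n * (p1 - q1) = - (p2 + q2) * d.
  have pp' : p2 ^+ 2 = 1 - p1 ^+ 2 by rewrite -pp; ring.
  have qq' : q2 ^+ 2 = 1 - q1 ^+ 2 by rewrite -qq; ring.
  rewrite nE /r /d.
  transitivity (- q1 * p2 ^+ 2 + p1 * q2 ^+ 2 + p1 * p2 * q2 - p2 * q1 * q2); last by ring.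
  by rewrite pp' qq'; field.
have e2 : 2^-1 * n * (p2 - q2) = (p1 + q1) * d.
  have pp' : p1 ^+ 2 = 1 - p2 ^+ 2 by rewrite -pp; ring.
  have qq' : q1 ^+ 2 = 1 - q2 ^+ 2 by rewrite -qq; ring.
  rewrite nE /r /d.
  transitivity (- q2 * p1 ^+ 2 + p2 * q1 ^+ 2 + p1 * p2 * q1 - p1 * q1 * q2); last by ring.
  by rewrite pp' qq'; field.
have f1 : (p2 + q2) * (d / n) = - (2^-1 * (p1 - q1)).
  apply: (mulIf nn0); rewrite -mulrA divfK //.
  by apply/eqP; rewrite -eqr_opp mulNr opprK mulrAC e1 mulNr; apply/eqP.
have f2 : (p1 + q1) * (d / n) = 2^-1 * (p2 - q2).
  by apply: (mulIf nn0); rewrite -mulrA divfK // mulrAC e2.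
split; first by rewrite n0 n4.
  apply/eqP; rewrite eq_complex complex_ReM complex_ImM /= f1 f2.
  by apply/andP; split; apply/eqP; field.
apply/eqP; rewrite eq_complex complex_ReM complex_ImM /= !mulrN f1 f2.
by apply/andP; split; apply/eqP; field.
Qed.

(** The converse of [unit_pair_split]. *)
Lemma unit_pair_of_sum a (s := Num.sqrt ((sqn a)^-1 - 4^-1)) : 0 < sqn a < 4 ->
  let p := a * (2^-1 +i* s)%C in let q := a * (2^-1 -i* s)%C in
  [/\ sqn p = 1, sqn q = 1, p + q = a &
      0 < complex.Im p * complex.Re q - complex.Re p * complex.Im q].
Proof.
move=> /andP[n0 n4]; have nn0 := lt0r_neq0 n0.
have s0 : 0 < (sqn a)^-1 - 4^-1 by rewrite subr_gt0 ltf_pV2 // posrE.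
have s2 : s ^+ 2 = (sqn a)^-1 - 4^-1 by rewrite sqr_sqrtr // ltW.
have sgt : 0 < s by rewrite sqrtr_gt0.
move=> p q; split.
- by rewrite /p sqnM /= s2; field.
- by rewrite /q sqnM /= sqrrN s2; field.
- rewrite /p /q -mulrDr (_ : _ + _ = 1) ?mulr1 //.
  by apply/eqP; rewrite eq_complex complex_ReD complex_ImD /= subrr eqxx andbT; apply/eqP; field.
rewrite /p /q !complex_ReM !complex_ImM /=.
by rewrite [X in 0 < X](_ : _ = sqn a * s); [exact: mulr_gt0 | field].
Qed.

End CircleLift.

(** * Continuity *)

Lemma continuous_complex_Re (R : realType) : continuous (fun a : R[i]^o => complex.Re a).
Proof.
move=> a A /nbhs_ballP[e /= e0 eA]; apply/nbhs_ballP.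
exists (e%:C)%C; first by rewrite /= ltcR.
move=> c /= ac; apply: eA; move: ac; rewrite /ball /= => ac.
rewrite -ltcR; apply: le_lt_trans ac; rewrite -[a - c]/((a : R[i]) - c).
by apply: le_trans (normc_ge_Re _); rewrite lecR; case: (a) (c) => [? ?] [? ?].
Qed.

Lemma continuous_complex_Im (R : realType) : continuous (fun a : R[i]^o => complex.Im a).
Proof.
move=> a A /nbhs_ballP[e /= e0 eA]; apply/nbhs_ballP.
exists (e%:C)%C; first by rewrite /= ltcR.
move=> c /= ac; apply: eA; move: ac; rewrite /ball /= => ac.
rewrite -ltcR; apply: le_lt_trans ac; rewrite -[a - c]/((a : R[i]) - c).
have N (d : R[i]) : `|complex.Im d|%:C%C <= `|d|.
  by rewrite normc_def lecR -sqrtr_sqr ler_wsqrtr // lerDr sqr_ge0.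
by apply: le_trans (N _); rewrite lecR; case: (a) (c) => [? ?] [? ?].
Qed.

(** Neighborhoods of a matrix are products of neighborhoods of its entries. *)
Lemma continuous_rV (R : realType) (T : topologicalType) k (f : T -> 'rV[R]_k) x :
  (forall i, {for x, continuous (fun y => f y ord0 i)}) -> {for x, continuous f}.
Proof.
move=> cf A [P /= fP PA]; apply: (@filterS _ (nbhs x) _ (fun y => forall i, P ord0 i (f y ord0 i))).
  by move=> y Py; apply: PA => /= i j; rewrite !ord1.
by apply: filter_forall => i; apply: cf; exact: fP.
Qed.

Lemma continuous_lincomb (R : realType) (T : topologicalType) (f g : T -> R) (a d : R) :
  continuous f -> continuous g -> continuous (fun y => f y * a + g y * d).
Proof.
move=> cf cg y.
suff : {for y, continuous (fun y => f y * a + g y * d)} by [].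
apply: continuousD; apply: continuousM;
  by [exact: cf | exact: cg | exact: cst_continuous].
Qed.

Section Positivity.
Variable R : realType.

Lemma near_pos (T : topologicalType) (f : T -> R) y :
  {for y, continuous f} -> 0 < f y -> \forall w \near y, 0 < f w.
Proof. by move=> cf; exact: (cvgr_gt _ cf). Qed.

Lemma open_pos_in (T : topologicalType) (U : set T) (f : T -> R) :
  open U -> (forall x, U x -> {for x, continuous f}) ->
  open [set x | U x /\ 0 < f x]%classic.
Proof.
move=> oU cf; rewrite openE => x [Ux fx]; apply: filterI.
  exact: open_nbhs_nbhs.
by apply: near_pos fx; exact: cf.
Qed.

End Positivity.

(** * Local lifts of the product of the coordinates *)

(** Shrink the domain so that [rho (phi x) / rho (phi u)] stays in the right half
    plane, where its argument is twice the arctangent of its stereographic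
    coordinate. *)
Lemma local_lift_exists (R : realType) (m k : nat) (X : set (Cspace R m)) U phi (u : 'rV[R]_k) :
  (X `<=` torus R m)%classic -> local_param X U phi -> U u ->
  exists U' h, local_lift X rho (phi u) U' phi u h.
Proof.
move=> Xt P Uu; have oU : open U by case: P.
pose rh x := rho (phi x).
have srho : csmooth U rh by apply: csmooth_prod => // l; exact: local_param_csmooth P.
have urho : unit_on U rh.
  by case: (angvel_prod (index_enum 'I_m) 0 oU (fun l => local_param_csmooth l P)
    (fun l => local_param_unit l Xt P) Uu).
pose G x := rh x * ((rh u)^*)%C.
have sG : csmooth U G by apply: csmoothM => //; exact: csmooth_cst.
have uG x : U x -> sqn (G x) = 1.
  by move=> Ux; rewrite /G sqnM sqnJ !urho // mulr1.
pose U' := [set x | U x /\ 0 < complex.Re (G x)]%classic.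
have oU' : open U' by apply: open_pos_in => //; exact: (sG.1 0%N).
have U'U : (U' `<=` U)%classic by move=> x [].
have CkW n f : Ck_on n U f -> Ck_on n U' f.
  elim: n f => [|n IH] f; first by move=> cf x /U'U; exact: cf.
  by move=> [df Df]; split=> [x /U'U|v]; [exact: df | exact/IH/Df].
have G0 x : U' x -> 0 < 1 + complex.Re (G x) by move=> [_ /= G0]; rewrite addr_gt0.
have [C rhC] := unit_expi (urho _ Uu).
pose h x := C + (atan (stereo_inv (G x)) + atan (stereo_inv (G x))).
exists U', h; split => //.
- case: P => _ sP iP dP oP; split => //.
  + by move=> l; have [s1 s2] := sP l; split => n; apply: CkW; [exact: s1 | exact: s2].
  + by move=> x y; rewrite !inE => /U'U Ux /U'U Uy; apply: iP; rewrite inE.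
  + by move=> x v /U'U; exact: dP.
  + by move=> V oV VU'; apply: oP => // x /VU' /U'U.
- by split => //=; rewrite /G mulJc ?urho.
- have sa : smooth_on U' (fun x => atan (stereo_inv (G x))).
    move=> n; apply: Ck_on_atan => //; apply: Ck_onM => //; first exact/CkW/(sG.2 n).
    apply: Ck_onV => //; first by move=> x /G0 /lt0r_neq0.
    by apply: Ck_onD => //; [exact: Ck_on_cst | exact/CkW/(sG.1 n)].
  by move=> n; apply: Ck_onD => //; [exact: Ck_on_cst | exact: Ck_onD].
move=> x U'x; have Ux := U'U _ U'x.
rewrite /h expiD -rhC expi_atan stereo_invK ?uG //; last exact: G0.
by rewrite /G mulrCA mulJc ?urho // mulr1.
Qed.

(** * Parametrization of the fiber *)

Lemma enum_but_two m (j l : 'I_m) : j != l ->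
  exists e : 'I_(m - 2) -> 'I_m,
    injective e /\ (forall t, (t != j) && (t != l) <-> exists i, e i = t).
Proof.
move=> jl; pose S := ~: [set j; l]%SET.
have cS : #|S| = (m - 2)%N.
  by have := cardsC [set j; l]%SET; rewrite cards2 jl card_ord => E; rewrite -[in RHS]E addKn.
exists (fun i => enum_val (cast_ord (esym cS) i)); split.
  by move=> i i' /enum_val_inj /cast_ord_inj.
move=> t; have <- : (t \in S) = (t != j) && (t != l) by rewrite !inE negb_or.
split=> [tS|[i <-]]; last exact: enum_valP.
by exists (cast_ord cS (enum_rank_in tS t)); rewrite cast_ordK enum_rankK_in.
Qed.

Section FiberChart.
Variables (R : realType) (m : nat) (b : R[i]) (z : Cspace R m).
Variables (j l : 'I_m) (e : 'I_(fiber_dim m) -> 'I_m).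

Local Notation k := (fiber_dim m).
Local Notation re y t := (complex.Re (y ord0 t : R[i])).
Local Notation im y t := (complex.Im (y ord0 t : R[i])).

Hypothesis z_fiber : fiber m b z.
Hypothesis jl_pos : 0 < im z j * re z l - re z j * im z l.
Hypothesis e_inj : injective e.
Hypothesis e_range : forall t, (t != j) && (t != l) <-> exists i, e i = t.

Implicit Types (x : 'rV[R]_k) (y : Cspace R m) (t : 'I_m).

(** The entry of [x] that belongs to the index [t]; the default value only
    occurs for the indices [j] and [l]. *)
Definition stereo_coord t x : R := if [pick i | e i == t] is Some i then x ord0 i else 0.

Definition free_coord t x : R[i] := (z ord0 t : R[i]) * stereo (stereo_coord t x).

(** What remains of [b] for the sum of the coordinates [j] and [l]. *)
Definition rest_sum x : R[i] := b - \sum_(t | (t != j) && (t != l)) free_coord t x.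

Definition half_height x : R := Num.sqrt ((sqn (rest_sum x))^-1 - 4^-1).

Definition chart_map x : Cspace R m := \row_t
  (if t == j then rest_sum x * (2^-1 +i* half_height x)%C
   else if t == l then rest_sum x * (2^-1 -i* half_height x)%C
   else free_coord t x).

Definition chart_dom : set 'rV[R]_k := [set x | 0 < sqn (rest_sum x) < 4]%classic.

(** The rotation that takes the coordinate [e i] of [z] to that of [y]. *)
Definition chart_turn (i : 'I_k) y : R[i] :=
  (y ord0 (e i) : R[i]) * ((z ord0 (e i) : R[i])^*)%C.

Definition chart_inv y : 'rV[R]_k := \row_i stereo_inv (chart_turn i y).

Lemma jl_neq : j != l.
Proof. by apply: contraTneq jl_pos => ->; rewrite mulrC subrr ltxx. Qed.

Lemma e_neq i : (e i != j) && (e i != l).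
Proof. by apply/e_range; exists i. Qed.

Lemma z_unit t : sqn (z ord0 t : R[i]) = 1.
Proof. by apply/normc1P; case: z_fiber => /(_ t). Qed.

Lemma stereo_coord_e i x : stereo_coord (e i) x = x ord0 i.
Proof.
rewrite /stereo_coord; case: pickP => [i' /eqP /e_inj -> //|/(_ i)].
by rewrite eqxx.
Qed.

Lemma free_coord_e i x : free_coord (e i) x = (z ord0 (e i) : R[i]) * stereo (x ord0 i).
Proof. by rewrite /free_coord stereo_coord_e. Qed.

Lemma chart_map_e i x : chart_map x ord0 (e i) = free_coord (e i) x.
Proof. by rewrite mxE; case/andP: (e_neq i) => /negPf -> /negPf ->. Qed.

Lemma chart_map_free t x : (t != j) && (t != l) -> chart_map x ord0 t = free_coord t x.
Proof. by move=> /e_range[i <-]; exact: chart_map_e. Qed.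

Lemma chart_map_j x : chart_map x ord0 j = rest_sum x * (2^-1 +i* half_height x)%C.
Proof. by rewrite mxE eqxx. Qed.

Lemma chart_map_l x : chart_map x ord0 l = rest_sum x * (2^-1 -i* half_height x)%C.
Proof. by rewrite mxE eq_sym (negPf jl_neq) eqxx. Qed.

Lemma sum_split (f : 'I_m -> R[i]) :
  \sum_t f t = f j + f l + \sum_(t | (t != j) && (t != l)) f t.
Proof.
by rewrite (bigD1 j) //= (bigD1 l) 1?eq_sym ?jl_neq //= addrA.
Qed.

Lemma chart_turn_map i x : chart_turn i (chart_map x) = stereo (x ord0 i).
Proof. by rewrite /chart_turn chart_map_e free_coord_e mulrAC mulJc ?mul1r // z_unit. Qed.

Lemma chart_mapK : cancel chart_map chart_inv.
Proof. by move=> x; apply/rowP => i; rewrite mxE chart_turn_map stereoK. Qed.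

Lemma chart_map_fiber x : chart_dom x -> fiber m b (chart_map x).
Proof.
move=> /unit_pair_of_sum[pj pl pS _]; split.
  move=> t; apply/normc1P; have [->|tj] := eqVneq t j; first by rewrite chart_map_j.
  have [->|tl] := eqVneq t l; first by rewrite chart_map_l.
  by rewrite chart_map_free ?tj // sqnM z_unit stereo_unit mul1r.
rewrite /fsum sum_split chart_map_j chart_map_l pS.
rewrite (eq_bigr (free_coord^~ x)) => [|t]; last exact: chart_map_free.
by rewrite /rest_sum subrK.
Qed.

Lemma chart_invK y : fiber m b y ->
  (forall i, 0 < 1 + complex.Re (chart_turn i y)) ->
  0 < im y j * re y l - re y j * im y l ->
  chart_map (chart_inv y) = y.
Proof.
move=> [yt yb] y0 yjl.
have yu t : sqn (y ord0 t : R[i]) = 1 by apply/normc1P; exact: yt.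
have fE t : (t != j) && (t != l) -> free_coord t (chart_inv y) = y ord0 t.
  move=> /e_range[i <-]; rewrite free_coord_e mxE stereo_invK //; last first.
    by rewrite sqnM sqnJ yu z_unit mulr1.
  by rewrite mulrCA mulJc ?mulr1 ?z_unit.
have rE : rest_sum (chart_inv y) = (y ord0 j : R[i]) + (y ord0 l : R[i]).
  rewrite /rest_sum (eq_bigr (fun t => y ord0 t : R[i])) // -yb /fsum sum_split.
  by rewrite addrK.
have [_ Ej El] := unit_pair_split (yu j) (yu l) yjl.
apply/rowP => t; have [->|tj] := eqVneq t j; first by rewrite chart_map_j /half_height rE -Ej.
have [->|tl] := eqVneq t l; first by rewrite chart_map_l /half_height rE -El.
by rewrite chart_map_free ?fE ?tj.
Qed.

Lemma chart_base : chart_map 0 = z /\ chart_dom 0.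
Proof.
have z0 : chart_inv z = 0.
  by apply/rowP => i; rewrite !mxE /chart_turn mulJc ?z_unit // /stereo_inv /= mul0r.
have E : chart_map 0 = z.
  by rewrite -z0 chart_invK // => i; rewrite /chart_turn mulJc ?z_unit //=.
split => //; rewrite /chart_dom /=.
have -> : rest_sum 0 = (z ord0 j : R[i]) + (z ord0 l : R[i]).
  rewrite /rest_sum (eq_bigr (fun t => z ord0 t : R[i])) => [|t tjl].
    by case: z_fiber => _ <-; rewrite /fsum sum_split addrK.
  by rewrite -(chart_map_free 0 tjl) E.
by case: (unit_pair_split (z_unit j) (z_unit l) jl_pos).
Qed.

Lemma stereo_csmooth (U : set 'rV[R]_k) (f : 'rV[R]_k -> R) : open U -> smooth_on U f ->
  csmooth U (fun x => stereo (f x)).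
Proof.
move=> oU sf; have s2 n : Ck_on n U (fun x => f x ^+ 2).
  by under [X in Ck_on _ _ X]funext do rewrite expr2; exact: Ck_onM.
have sV n : Ck_on n U (fun x => (1 + f x ^+ 2)^-1).
  apply: Ck_onV => //; first by move=> x _; exact: sqr_add1_neq0.
  by apply: Ck_onD => //; exact: Ck_on_cst.
split=> n; apply: Ck_onM => //; first by apply: Ck_onB => //; exact: Ck_on_cst.
by apply: Ck_onM => //; exact: Ck_on_cst.
Qed.

Lemma free_coord_csmooth U t : open U -> csmooth U (free_coord t).
Proof.
move=> oU; apply: csmoothM => //; first exact: csmooth_cst.
apply: stereo_csmooth => // n; rewrite /stereo_coord; case: pickP => [i _|_].
  exact: Ck_on_coord.
exact: Ck_on_cst.
Qed.

Lemma rest_sum_csmooth U : open U -> csmooth U rest_sum.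
Proof.
move=> oU; have sF t := free_coord_csmooth t oU.
have E x : complex.Re (rest_sum x) = complex.Re b -
    \sum_(t | (t != j) && (t != l)) complex.Re (free_coord t x).
  by rewrite /rest_sum -complex_Re_sum; case: b (\sum_(t | _) _) => [? ?] [? ?].
have E' x : complex.Im (rest_sum x) = complex.Im b -
    \sum_(t | (t != j) && (t != l)) complex.Im (free_coord t x).
  by rewrite /rest_sum -complex_Im_sum; case: b (\sum_(t | _) _) => [? ?] [? ?].
split => n.
  under [X in Ck_on _ _ X]funext do rewrite E.
  apply: Ck_onB => //; first exact: Ck_on_cst.
  by apply: Ck_on_sum => // t _; exact: (sF t).1.
under [X in Ck_on _ _ X]funext do rewrite E'.
apply: Ck_onB => //; first exact: Ck_on_cst.
by apply: Ck_on_sum => // t _; exact: (sF t).2.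
Qed.

Lemma rest_sqn_smooth U : open U -> smooth_on U (fun x => sqn (rest_sum x)).
Proof.
move=> oU n; have [rS iS] := rest_sum_csmooth oU.
by under [X in Ck_on _ _ X]funext do rewrite !expr2; apply: Ck_onD => //; exact: Ck_onM.
Qed.

Lemma chart_dom_open : open chart_dom.
Proof.
have cN (x : 'rV[R]_k) : {for x, continuous (fun x => sqn (rest_sum x))}.
  exact: (rest_sqn_smooth openT 0%N).
have oN : open [set x | setT x /\ 0 < sqn (rest_sum x)]%classic.
  by apply: (open_pos_in openT) => x _; exact: cN.
have -> : chart_dom =
    [set x | (setT x /\ 0 < sqn (rest_sum x)) /\ 0 < 4 - sqn (rest_sum x)]%classic.
  apply/seteqP; split=> x /=; rewrite subr_gt0; first by move=> /andP[].
  by move=> [[_ a] c]; exact/andP.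
apply: (open_pos_in oN) => x _; apply: continuousB; first exact: cst_continuous.
exact: cN.
Qed.

Lemma chart_map_csmooth t : csmooth chart_dom (fun x => chart_map x ord0 t : R[i]).
Proof.
have oU := chart_dom_open; have [rS iS] := rest_sum_csmooth oU.
have sH : smooth_on chart_dom half_height.
  move=> n; have sqx := rest_sqn_smooth oU n.
  apply: Ck_on_sqrt => // [x /andP[n0 n4]|].
    by rewrite subr_gt0 ltf_pV2 // posrE.
  apply: Ck_onB => //; last exact: Ck_on_cst.
  by apply: Ck_onV => // x /andP[/lt0r_neq0].
have [->|tj] := eqVneq t j.
  under [X in csmooth _ X]funext do rewrite chart_map_j.
  by apply: csmoothM => //; split => n //; exact: Ck_on_cst.
have [->|tl] := eqVneq t l.
  under [X in csmooth _ X]funext do rewrite chart_map_l.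
  apply: csmoothM => //; split => n /=; first exact: Ck_on_cst.
  under [X in Ck_on _ _ X]funext do rewrite -mulN1r.
  by apply: Ck_onM => //; exact: Ck_on_cst.
under [X in csmooth _ X]funext do rewrite chart_map_free ?tj //.
exact: free_coord_csmooth.
Qed.

(** Each entry [w_i] of the parameter satisfies [w_i (1 + Re s) = Im s] for
    [s = stereo w_i], which is a coordinate of [chart_map w] up to a constant
    factor. So the derivative of [w_i] vanishes with that of [s]. *)
Lemma chart_immersion x (v : 'rV[R]_k) : chart_dom x ->
  (forall t, 'D_v (fun w : 'rV[R]_k => complex.Re (chart_map w ord0 t : R[i])) x = 0 /\
             'D_v (fun w : 'rV[R]_k => complex.Im (chart_map w ord0 t : R[i])) x = 0) ->
  v = 0.
Proof.
move=> Ux Dv; apply/rowP => i; rewrite [RHS]mxE.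
have [Dr Di] := Dv (e i); have [dr di] := csmooth_diff (chart_map_csmooth (e i)) Ux.
set c := ((z ord0 (e i) : R[i])^*)%C.
have dcst (a : R) : differentiable (fun=> a : R) x by exact: differentiable_cst.
have DC (f : 'rV[R]_k -> R) a : differentiable f x -> 'D_v f x = 0 ->
    'D_v (fun w : 'rV[R]_k => f w * a) x = 0.
  move=> df D0; rewrite deriveM; [|exact: diff_derivable..].
  by rewrite derive_cst D0 !scaler0 addr0.
have DrG : 'D_v (fun w : 'rV[R]_k => complex.Re (stereo (w ord0 i))) x = 0.
  rewrite (open_eq_derive (g := fun w : 'rV[R]_k => re (chart_map w) (e i) * complex.Re c
    - im (chart_map w) (e i) * complex.Im c) v openT I) => [|w _].
    rewrite deriveB; [|by apply/diff_derivable/differentiableM..].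
    by rewrite !DC // subrr.
  by rewrite -chart_turn_map complex_ReM.
have DiG : 'D_v (fun w : 'rV[R]_k => complex.Im (stereo (w ord0 i))) x = 0.
  rewrite (open_eq_derive (g := fun w : 'rV[R]_k => re (chart_map w) (e i) * complex.Im c
    + im (chart_map w) (e i) * complex.Re c) v openT I) => [|w _].
    rewrite deriveD; [|by apply/diff_derivable/differentiableM..].
    by rewrite !DC // addr0.
  by rewrite -chart_turn_map complex_ImM.
have [sr si] := csmooth_diff (stereo_csmooth openT (fun n => Ck_on_coord setT n i)) (I : setT x).
have dx : differentiable (fun w : 'rV[R]_k => w ord0 i) x by exact: differentiable_coord.
have := open_eq_derive (f := fun w : 'rV[R]_k => complex.Im (stereo (w ord0 i)))
  (g := fun w : 'rV[R]_k => w ord0 i * (1 + complex.Re (stereo (w ord0 i)))) v openT (I : setT x).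
rewrite DiG deriveM; [|exact: diff_derivable|by apply/diff_derivable/differentiableD].
rewrite deriveD; [|exact: diff_derivable..].
rewrite derive_cst DrG derive_coord addr0 scaler0 add0r => E.
have /esym/eqP : 0 = (1 + complex.Re (stereo (x ord0 i))) *: v ord0 i.
  apply: E => w _; rewrite -{2}(stereoK (w ord0 i)) /stereo_inv.
  by rewrite divfK // lt0r_neq0 // stereo_Re_gt.
by rewrite scaler_eq0 (negPf (lt0r_neq0 (stereo_Re_gt _))) /= => /eqP.
Qed.

Lemma re_continuous t : continuous (fun y => re y t).
Proof.
move=> y; apply: (@continuous_comp _ _ _ (fun y => y ord0 t) (fun a : R[i]^o => complex.Re a)).
  exact: coord_continuous.
exact: continuous_complex_Re.
Qed.

Lemma im_continuous t : continuous (fun y => im y t).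
Proof.
move=> y; apply: (@continuous_comp _ _ _ (fun y => y ord0 t) (fun a : R[i]^o => complex.Im a)).
  exact: coord_continuous.
exact: continuous_complex_Im.
Qed.

Lemma chart_turn_continuous i :
  continuous (fun y => complex.Re (chart_turn i y)) /\
  continuous (fun y => complex.Im (chart_turn i y)).
Proof.
pose c := ((z ord0 (e i) : R[i])^*)%C.
have -> : (fun y => complex.Re (chart_turn i y)) =
    (fun y => re y (e i) * complex.Re c - im y (e i) * complex.Im c).
  by apply/funext => y; exact: complex_ReM.
have -> : (fun y => complex.Im (chart_turn i y)) =
    (fun y => re y (e i) * complex.Im c + im y (e i) * complex.Re c).
  by apply/funext => y; exact: complex_ImM.
split; last by apply: continuous_lincomb; [exact: re_continuous | exact: im_continuous].
have -> : (fun y => re y (e i) * complex.Re c - im y (e i) * complex.Im c) =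
    (fun y => re y (e i) * complex.Re c + im y (e i) * - complex.Im c).
  by apply/funext => y; rewrite mulrN.
by apply: continuous_lincomb; [exact: re_continuous | exact: im_continuous].
Qed.

Lemma chart_inv_continuous y : (forall i, 0 < 1 + complex.Re (chart_turn i y)) ->
  {for y, continuous chart_inv}.
Proof.
move=> y0; apply: continuous_rV => i; have [cr ci] := chart_turn_continuous i.
have -> : (fun y => chart_inv y ord0 i) =
    (fun y => complex.Im (chart_turn i y) * (1 + complex.Re (chart_turn i y))^-1).
  by apply/funext => w; rewrite mxE.
apply: continuousM; first exact: ci.
apply: continuousV; first exact: lt0r_neq0.
by apply: continuousD; [exact: cst_continuous | exact: cr].
Qed.

(** On the open set of points where [chart_inv] is defined and the coordinates
    [j] and [l] are in the right order, [chart_inv] is continuous and inverts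
    [chart_map]; take for [W] the preimage of [V] under it. *)
Lemma chart_open (V : set 'rV[R]_k) : open V -> (V `<=` chart_dom)%classic ->
  exists2 W : set (Cspace R m), open W & (chart_map @` V = fiber m b `&` W)%classic.
Proof.
move=> oV VU; exists [set y | [/\ forall i, 0 < 1 + complex.Re (chart_turn i y),
    0 < im y j * re y l - re y j * im y l & V (chart_inv y)]]%classic.
  rewrite openE => y [y0 yjl Vy].
  have near0 : nbhs y [set w | forall i, 0 < 1 + complex.Re (chart_turn i w)]%classic.
    apply: (@filter_forall _ _ (fun i w => 0 < 1 + complex.Re (chart_turn i w)) _ (nbhs_filter y)) => i.
    apply: (@near_pos R (Cspace R m) (fun w => 1 + complex.Re (chart_turn i w)) y) => //.
    by apply: continuousD; [exact: cst_continuous | exact: (chart_turn_continuous i).1].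
  have nearjl : nbhs y [set w | 0 < im w j * re w l - re w j * im w l]%classic.
    apply: (@near_pos R (Cspace R m) (fun w => im w j * re w l - re w j * im w l) y) => //;
       apply: continuousB; apply: continuousM;
      by [exact: re_continuous | exact: im_continuous].
  have nearV : nbhs y (chart_inv @^-1` V)%classic.
    by apply: (chart_inv_continuous y0); exact: open_nbhs_nbhs.
  apply: filterS (filterI near0 (filterI nearjl nearV)) => w [w0 [wjl Vw]].
  by split.
apply/seteqP; split=> [_ [x Vx <-]|y [yF [y0 yjl Vy]]].
  have Ux := VU _ Vx; split; first exact: chart_map_fiber.
  split=> [i||]; last by rewrite chart_mapK.
    by rewrite chart_turn_map stereo_Re_gt.
  by rewrite chart_map_j chart_map_l; case: (unit_pair_of_sum Ux).
by exists (chart_inv y) => //; exact: chart_invK.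
Qed.

Lemma chart_param : local_param (fiber m b) chart_dom chart_map.
Proof.
split.
- exact: chart_dom_open.
- by move=> t; exact: chart_map_csmooth.
- by move=> x y _ _ /(congr1 chart_inv); rewrite !chart_mapK.
- exact: chart_immersion.
- exact: chart_open.
Qed.

End FiberChart.

(** * The Morse function and its indices *)

Theorem proposition7p5 (R : realType) (m : nat) (b : R[i])
    (m_ge1 : (1 <= m)%N)
    (b_reg : regular_value m (torus R m) fsum b) :
  morse_function (fiber_dim m) (fiber m b) rho /\
  (forall (K : {set 'I_m}) (z : Cspace R m),
     K != finset.set0 -> K != [set: 'I_m]%SET ->
     is_zK b K z ->
     morse_index (fiber_dim m) (fiber m b) rho z (#|K| - 1)%N).
Proof.
have Xt : (fiber m b `<=` torus R m)%classic by move=> y [].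
have crit_in z : critical_point (fiber_dim m) (fiber m b) rho z -> fiber m b z.
  by move=> [U [phi [u [h [[P Uu <- _ _] _]]]]]; exact: local_param_in P Uu.
have main z U phi u h : critical_point (fiber_dim m) (fiber m b) rho z ->
    local_lift (fiber m b) rho z U phi u (h : 'rV[R]_(fiber_dim m) -> R) ->
    hessian h u \in unitmx /\ form_index (hessian h u) (#|Kset b z| - 1).
  move=> cz L; have [j [l jl]] := regular_nonparallel m_ge1 b_reg (crit_in z cz).
  have [a [d ad]] := critical_multiplier jl cz.
  exact: critical_hessian jl ad L.
split; first split.
- move=> z zF; have [j [l jl]] := regular_nonparallel m_ge1 b_reg zF.
  have [e [e_inj e_range]] := enum_but_two (jl_neq jl).
  have [c0 U0] := chart_base zF jl e_inj e_range.
  have P := chart_param zF jl e_inj e_range.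
  have [U' [h L]] := local_lift_exists Xt P U0; rewrite c0 in L.
  by exists U', (chart_map b z j l e), 0, h.
- by move=> z cz U phi u h /(main _ _ _ _ _ cz)[].
move=> K z _ _ [cz <-] U phi u h L.
by have [] := main _ _ _ _ _ cz L.
Qed.
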